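(* Let $G$ be a compact Lie group and let $C$ be a conjugacy class in $G$ such that $p^2\in Z(G)$ for every $p\in C$, where $Z(G)$ is the center of $G$. Let $m\ge 1$, let $\mathcal C=(C,\dots,C)$ ($m$ copies), and let $\omega_{\mathcal C}$ and $\mathscr M\subset C^m=\prod_{j=1}^m C$ be the $2$-form and the braid-invariant open neighbourhood of $K=\{(g_1,\dots,g_m)\in C^m : g_1\cdots g_m=e\}$ described in the context, on which $\omega_{\mathcal C}$ is symplectic. Then for every braid $\sigma\in\mathcal B_m$ the symplectic form satisfies $$\sigma^*(\omega_{\mathcal C})=\omega_{\mathcal C}$$ on $\mathscr M$; i.e. the braid group $\mathcal B_m$ acts on $\mathscr M$ through symplectomorphisms.
   Context: Let $\mathfrak g$ be the Lie algebra of $G$, equipped with an $\mathrm{Ad}$-invariant positive definite inner product $\bullet$. Let $\omega$ (resp. $\bar\omega$) be the left-invariant (resp. right-invariant) $\mathfrak g$-valued Maurer--Cartan $1$-form on $G$: $\omega(g\cdot X)=X$, $\bar\omega(X\cdot g)=X$ for $X\in\mathfrak g$, $g\in G$. On $G\times G$ define the $2$-form $\Omega=\frac12\,\omega_1\bullet\bar\omega_2$, i.e. $\Omega(U,V)=\frac12\big(\omega_1(U)\bullet\bar\omega_2(V)-\bar\omega_2(U)\bullet\omega_1(V)\big)$, where the index $j$ denotes pull-back by the projection to the $j$-th factor. For conjugacy classes $C_1,\dots,C_m$ of $G$ and $\mathcal C=(C_1,\dots,C_m)$ let $r:C_1\times\dots\times C_m\to G$, $r(g_1,\dots,g_m)=g_1\cdots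 g_m$, and $K=r^{-1}(e)$. For $1\le j\le m-1$ let $E_j(g_1,\dots,g_m)=(g_1\cdots g_j,\,g_{j+1})\in G\times G$ and put $\omega_c=-\sum_{j=1}^{m-1}E_j^*\Omega$, a $2$-form on $C_1\times\dots\times C_m$. Let $\lambda$ be the left-invariant $3$-form on $G$ with $\lambda_e(x,y,z)=\frac12[x,y]\bullet z$, and $\beta=h(\exp^*\lambda)$, where $h:\Omega^*(\mathfrak g)\to\Omega^{*-1}(\mathfrak g)$ is the standard homotopy operator given by integration along linear paths from the origin, $(h\alpha)_x(v_1,\dots,v_{p-1})=\int_0^1t^{p-1}\alpha_{tx}(x,v_1,\dots,v_{p-1})\,dt$. Let $\widetilde{\mathscr O}\subset\mathfrak g$ be an open $\mathrm{Ad}$-invariant subset, star-shaped with respect to $0\in\widetilde{\mathscr O}$, on which $\exp$ is a diffeomorphism onto $\exp(\widetilde{\mathscr O})$; let $\mathscr H=r^{-1}(\exp(\widetilde{\mathscr O}))$ and $\tilde r=\exp^{-1}\circ r:\mathscr H\to\widetilde{\mathscr O}$. On each conjugacy class $C_i$ let $\tau_i$ be the $2$-form $\tau_i(Xp-pX,\,Yp-pY)=\frac12\big(X\bullet \mathrm{Ad}(p)Y-Y\bullet \mathrm{Ad}(p)X\big)$, $p\in C_i$, $X,Y\in\mathfrak g$. With $f_i$ the projection to $C_i$, define on $\mathscr H$ the $2$-form $\omega_{\mathcal C}=\omega_c-\tilde r^*\beta+\sum_i f_i^*\tau_i$. It is a theorem of Guruprasad--Huebschmann--Jeffrey--Weinstein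 that there is a $G$-invariant open neighbourhood $\mathscr M$ of $K$ in $\mathscr H$ on which $\omega_{\mathcal C}$ is symplectic (closed and non-degenerate). When $C_1=\dots=C_m=C$, the braid group $\mathcal B_m$ with elementary braids $\sigma_1,\dots,\sigma_{m-1}$ acts from the left on $C^m$ by $\sigma_k(g_1,\dots,g_m)=(g_1,\dots,g_{k-1},\,g_kg_{k+1}g_k^{-1},\,g_k,\,g_{k+2},\dots,g_m)$. One has $r\circ\sigma=r$ for all $\sigma\in\mathcal B_m$. The neighbourhood $\mathscr M$ is chosen of the form $\mathscr M=r^{-1}(U)$, with $U$ an open conjugation-invariant neighbourhood of $e$ in $G$; hence $\mathscr M$ is $\mathcal B_m$-invariant. *)

(* Defs.v *)
From HB Require Import structures.
From mathcomp Require Import all_boot all_order all_algebra.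
From mathcomp Require Import all_classical all_reals all_analysis.

Set Implicit Arguments.
Unset Strict Implicit.
Unset Printing Implicit Defensive.

Import Order.TTheory GRing.Theory Num.Theory.
Import numFieldNormedType.Exports.

Local Open Scope classical_set_scope.
Local Open Scope ring_scope.

(** [Ck k D f]: [f] is of class [C^k] on the open set [D].  Continuity of all
    iterated directional derivatives is the usual notion because every model
    space [E] used below is finite dimensional. *)
Fixpoint Ck (R : realType) (E F : normedModType R) (k : nat) (D : set E)
    (f : E -> F) : Prop :=
  match k with
  | 0%N => forall x, D x -> {for x, continuous f}
  | k'.+1 => (forall x, D x -> differentiable f x) /\
             (forall v, Ck k' D (fun x => 'd f x v))
  end.

Definition Coo (R : realType) (E F : normedModType R) (D : set E) (f : E -> F) :=
  forall k, Ck k D f.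

Record chart (E M : Type) := Chart {
  chart_dom : set M;
  chart_fun : M -> E;
  chart_inv : E -> M
}.

(** A space with a preferred chart [chart_at x] around each of its points [x].
    The tangent space at [x] is the model space [E], a tangent vector being
    represented by its coordinates in [chart_at x].  This structure carries data
    only; that the charts form a smooth atlas is [smooth_atlas]. *)
HB.mixin Record isCharted (R : realType) (E : normedModType R) M
    of Topological M := {
  chart_at : M -> chart E M
}.

#[short(type="chartedType")]
HB.structure Definition Charted (R : realType) (E : normedModType R) :=
  {M of Topological M & isCharted R E M}.

Section Manifolds.
Context (R : realType).

Definition smooth_atlas (E : normedModType R) (M : chartedType E) : Prop :=
  (forall x : M, let c := chart_at x in
     [/\ chart_dom c x, open (chart_dom c), open (chart_fun c @` chart_dom c),
         {in chart_dom c, cancel (chart_fun c) (chart_inv c)} &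
         (forall y, chart_dom c y -> {for y, continuous (chart_fun c)}) /\
         (forall y, chart_dom c y ->
            {for chart_fun c y, continuous (chart_inv c)})]) /\
  (forall x y : M, let c := chart_at x in let c' := chart_at y in
     Coo (chart_fun c @` (chart_dom c `&` chart_dom c'))
         (chart_fun c' \o chart_inv c)).

Section Maps.
Context (E F : normedModType R) (M : chartedType E) (N : chartedType F).

Definition in_charts (f : M -> N) (x : M) : E -> F :=
  chart_fun (chart_at (f x)) \o f \o chart_inv (chart_at x).

Definition mdiff (f : M -> N) (x : M) : E -> F :=
  'd (in_charts f x) (chart_fun (chart_at x) x).

(** [D] is meant to be open. *)
Definition smooth_on (D : set M) (f : M -> N) : Prop :=
  forall x, D x -> {for x, continuous f} /\
    exists2 W, open_nbhs (chart_fun (chart_at x) x) W & Coo W (in_charts f x).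

Definition pullback2 (f : M -> N) (a : N -> F -> F -> R) : M -> E -> E -> R :=
  fun x u v => a (f x) (mdiff f x u) (mdiff f x v).

Definition pullback3 (f : M -> N) (a : N -> F -> F -> F -> R) :
    M -> E -> E -> E -> R :=
  fun x u v w => a (f x) (mdiff f x u) (mdiff f x v) (mdiff f x w).

End Maps.

Definition smooth (E F : normedModType R) (M : chartedType E)
  (N : chartedType F) (f : M -> N) : Prop := smooth_on setT f.

End Manifolds.

Definition flat_chart (E : Type) : chart E E := Chart setT id id.

HB.instance Definition _ (R : realType) :=
  @isCharted.Build R R^o R^o (fun=> flat_chart R^o).

HB.instance Definition _ (R : realType) (n : nat) :=
  @isCharted.Build R 'rV[R]_n 'rV[R]_n (fun=> flat_chart 'rV[R]_n).

HB.instance Definition _ (R : realType) (E F : normedModType R)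
    (M : chartedType E) (N : chartedType F) :=
  @isCharted.Build R (E * F)%type (M * N)%type (fun p =>
    let c := chart_at p.1 in let c' := chart_at p.2 in
    Chart (chart_dom c `*` chart_dom c')
      (fun q => (chart_fun c q.1, chart_fun c' q.2))
      (fun e => (chart_inv c e.1, chart_inv c' e.2))).

(** The [m]-fold power of [M], with the product topology.  If [M] has model
    space [R^n], then the model space of the power is [(R^n)^m], the space of
    [m * n] matrices: row [i] of a tangent vector is its component along the
    [i]-th factor. *)
Definition power (m : nat) (M : Type) := prod_topology (fun _ : 'I_m => M).

HB.instance Definition _ (m : nat) (M : topologicalType) :=
  Topological.on (power m M).

HB.instance Definition _ (R : realType) (m n : nat) (M : chartedType 'rV[R]_n) :=
  @isCharted.Build R 'M[R]_(m, n) (power m M) (fun x =>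
    Chart [set y | forall i, chart_dom (chart_at (x i)) (y i)]
      (fun y => \matrix_(i, j) chart_fun (chart_at (x i)) (y i) 0 j)
      (fun A i => chart_inv (chart_at (x i)) (row i A))).

HB.mixin Record isLieGroup (R : realType) (n : nat) G
    of Group G & Charted R 'rV[R]_n G := {
  lie_hausdorff : hausdorff_space G;
  lie_atlas : smooth_atlas G;
  smooth_mulg : smooth (fun p : G * G => (p.1 * p.2)%g : G);
  smooth_invg : smooth (fun g : G => (g^-1)%g : G)
}.

(** Lie groups of dimension [n].  The Lie algebra, i.e. the tangent space at the
    identity, is ['rV[R]_n]. *)
#[short(type="lieGroupType")]
HB.structure Definition LieGroup (R : realType) (n : nat) :=
  {G of Group G & Charted R 'rV[R]_n G & isLieGroup R n G}.

Section LieGroups.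
Context (R : realType) (n : nat) (G : lieGroupType R n).
Implicit Types (g h p : G) (X Y Z u v w : 'rV[R]_n).

(** [g . X] and [X . g]; as [(g * 1)%g = g], these are tangent vectors at [g]. *)
Definition ltrans g X := mdiff (fun h : G => (g * h)%g : G) 1%g X.
Definition rtrans X g := mdiff (fun h : G => (h * g)%g : G) 1%g X.

(** The Maurer-Cartan forms: [u] in [T_g G] is translated back to [T_1 G]. *)
Definition mcL g u := mdiff (fun h : G => (g^-1 * h)%g : G) g u.
Definition mcR g u := mdiff (fun h : G => (h * g^-1)%g : G) g u.

Definition Ad g X := mdiff (fun h : G => (g * h * g^-1)%g : G) 1%g X.

(** [[X, Y]] is the value at [1] of the commutator of the left-invariant vector
    fields [g |-> g . X] and [g |-> g . Y], as derivations of functions. *)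
Definition lie_bracket X Y : 'rV[R]_n :=
  xget 0 [set Z | forall f : G -> R^o, smooth f ->
    mdiff f 1%g Z = mdiff (fun g => mdiff f g (ltrans g Y) : R^o) 1%g X
                  - mdiff (fun g => mdiff f g (ltrans g X) : R^o) 1%g Y].

Definition one_parameter_subgroup X (c : R^o -> G) : Prop :=
  [/\ smooth c, forall s t, c (s + t) = (c s * c t)%g & mdiff c 0 1 = X].

(** There is exactly one one-parameter subgroup with initial velocity [X]. *)
Definition lie_exp X : G :=
  xget 1%g [set g | exists2 c, one_parameter_subgroup X c & g = c 1].

Record invariant_inner_product (dot : 'rV[R]_n -> 'rV[R]_n -> R) : Prop := {
  dot_linear : forall (a : R) X Y Z, dot (a *: X + Y) Z = a * dot X Z + dot Y Z;
  dot_sym : forall X Y, dot X Y = dot Y X;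
  dot_pos : forall X, X != 0 -> 0 < dot X X;
  dot_Ad : forall g X Y, dot (Ad g X) (Ad g Y) = dot X Y
}.

Definition lie_log (O : set 'rV[R]_n) (g : G) : 'rV[R]_n :=
  xget 0 [set X | O X /\ lie_exp X = g].

Record exp_domain (O : set 'rV[R]_n) : Prop := {
  exp_domain_open : open O;
  exp_domain_Ad : forall g X, O X -> O (Ad g X);
  exp_domain0 : O 0;
  exp_domain_star : forall (t : R) X, 0 <= t <= 1 -> O X -> O (t *: X);
  exp_domain_inj : forall X Y, O X -> O Y -> lie_exp X = lie_exp Y -> X = Y;
  exp_domain_open_image : open (lie_exp @` O);
  exp_domain_smooth : smooth_on O lie_exp;
  exp_domain_smooth_log : smooth_on (lie_exp @` O) (lie_log O)
}.

Definition conjugacy_class (C : set G) : Prop :=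
  exists p, C = [set (g * p * g^-1)%g | g in [set: G]].

Section Forms.
Variable dot : 'rV[R]_n -> 'rV[R]_n -> R.

Definition Omega (p : G * G) (U V : 'rV[R]_n * 'rV[R]_n) : R :=
  2^-1 * (dot (mcL p.1 U.1) (mcR p.2 V.2) - dot (mcR p.2 U.2) (mcL p.1 V.1)).

Definition lambda g u v w : R :=
  2^-1 * dot (lie_bracket (mcL g u) (mcL g v)) (mcL g w).

(** Integration along the segment from [0] to [x], for a [3]-form [a]. *)
Definition homotopy3 (a : 'rV[R]_n -> 'rV[R]_n -> 'rV[R]_n -> 'rV[R]_n -> R)
    (x v w : 'rV[R]_n) : R :=
  \int[lebesgue_measure]_(t in `[0, 1]) (t ^+ 2 * a (t *: x) x v w).

Definition beta : 'rV[R]_n -> 'rV[R]_n -> 'rV[R]_n -> R :=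
  homotopy3 (pullback3 lie_exp lambda).

(** The tangent vector [X p - p X] to the conjugacy class of [p]. *)
Definition orbit_vec X p : 'rV[R]_n := rtrans X p - ltrans p X.

(** The form on the conjugacy class of [p] with
    [tau p (X p - p X) (Y p - p Y) = (X . Ad p Y - Y . Ad p X) / 2];
    the right-hand side depends on [X p - p X] and [Y p - p Y] only. *)
Definition tau p u v : R :=
  xget 0 [set t | exists X Y, [/\ u = orbit_vec X p, v = orbit_vec Y p &
    t = 2^-1 * (dot X (Ad p Y) - dot Y (Ad p X))]].

(** Forms on [C ^ m] are given on tangent vectors to [G ^ m]; only their values
    on [tangent_class], the tangent spaces to [C ^ m], matter. *)
Context (m : nat).
Implicit Types (x : power m G) (A B : 'M[R]_(m, n)).

Definition tangent_class x : set 'M[R]_(m, n) :=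
  [set A | forall i, exists X, row i A = orbit_vec X (x i)].

Definition rprod x : G := \big[*%g/1%g]_(i < m) x i.

(** Indices start at [0]: for [0 < j < m], this is
    [(x_0 * ... * x_(j - 1), x_j)]. *)
Definition Epair (j : 'I_m) x : G * G :=
  (\big[*%g/1%g]_(i < m | (i < j)%N) x i, x j).

Definition omega_c x A B : R :=
  - \sum_(j < m | (0 < j)%N) pullback2 (Epair j) Omega x A B.

Definition omegaC (O : set 'rV[R]_n) x A B : R :=
  omega_c x A B
  - pullback2 (fun y : power m G => lie_log O (rprod y)) beta x A B
  + \sum_(i < m) tau (x i) (row i A) (row i B).

Definition class_preimage (C U : set G) : set (power m G) :=
  [set x | (forall i, C (x i)) /\ U (rprod x)].

End Forms.
End LieGroups.

Section Submanifolds.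
Context (R : realType) (E : normedModType R) (M : chartedType E).

(** The inverse of a chart of the embedded submanifold [S] of [M]: an injective
    immersion of an open subset [W] of [R^d], which is a homeomorphism onto an
    open subset of [S]. *)
Definition local_parametrization (S : set M) (d : nat) (W : set 'rV[R]_d)
    (f : 'rV[R]_d -> M) : Prop :=
  [/\ open W, smooth_on W f,
      (forall y, W y -> injective (mdiff f y)),
      (forall y z, W y -> W z -> f y = f z -> y = z) &
      forall W', open W' -> W' `<=` W ->
        exists2 V, open V & f @` W' = S `&` V].

(** [d a = 0] for a [2]-form [a] on [S], computed in the charts of [S] by the
    formula for the exterior derivative on constant vector fields. *)
Definition closed_form (S : set M) (a : M -> E -> E -> R) : Prop :=
  forall d (W : set 'rV[R]_d) (f : 'rV[R]_d -> M),
    local_parametrization S W f ->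
    forall y, W y -> forall u v w : 'rV[R]_d,
      let b := pullback2 f a in
      'D_u (fun z => b z v w : R^o) y - 'D_v (fun z => b z u w : R^o) y
      + 'D_w (fun z => b z u v : R^o) y = 0.

(** [TS x] is the tangent space at [x] to the submanifold [S]. *)
Definition symplectic (S : set M) (TS : M -> set E) (a : M -> E -> E -> R) :
    Prop :=
  closed_form S a /\
  (forall x u, S x -> TS x u -> (forall v, TS x v -> a x u v = 0) -> u = 0).

(** Maps between subsets of [M] are smooth if they extend to smooth maps on
    open neighbourhoods. *)
Definition smooth_near (S : set M) (f : M -> M) : Prop :=
  exists N, [/\ open N, S `<=` N & smooth_on N f].

Definition symplectomorphism (S : set M) (TS : M -> set E)
    (a : M -> E -> E -> R) (f : M -> M) : Prop :=
  [/\ set_bij S S f, smooth_near S f,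
      (exists2 f', {in S, cancel f f'} & smooth_near S f') &
      forall x u v, S x -> TS x u -> TS x v -> pullback2 f a x u v = a x u v].

End Submanifolds.

(** The letter [(k, true)] stands for the elementary braid [sigma_(k + 1)], and
    [(k, false)] for its inverse. *)
Definition braid_word (m : nat) := seq ('I_m.-1 * bool).

HB.instance Definition _ (m : nat) := Choice.on (braid_word m).

Inductive braid_rel (m : nat) : braid_word m -> braid_word m -> Prop :=
| BraidRefl w : braid_rel w w
| BraidSym w w' : braid_rel w w' -> braid_rel w' w
| BraidTrans w w' w'' : braid_rel w w' -> braid_rel w' w'' -> braid_rel w w''
| BraidCat w1 w1' w2 w2' : braid_rel w1 w1' -> braid_rel w2 w2' ->
    braid_rel (w1 ++ w2) (w1' ++ w2')
| BraidCancel k b : braid_rel [:: (k, b); (k, ~~ b)] [::]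
| BraidFar (k l : 'I_m.-1) : (k.+1 < l)%N ->
    braid_rel [:: (k, true); (l, true)] [:: (l, true); (k, true)]
| BraidNear (k l : 'I_m.-1) : k.+1 = l :> nat ->
    braid_rel [:: (k, true); (l, true); (k, true)]
              [:: (l, true); (k, true); (l, true)].

Section BraidGroup.
Context (m : nat).
Implicit Types (w : braid_word m).

Definition braid_relb w w' : bool := `[< braid_rel w w' >].

Lemma braid_relb_refl : reflexive braid_relb.
Proof. by move=> w; apply/asboolP; exact: BraidRefl. Qed.

Lemma braid_relb_sym : symmetric braid_relb.
Proof. by move=> w w'; apply/asboolP/asboolP => /BraidSym. Qed.

Lemma braid_relb_trans : transitive braid_relb.
Proof.
by move=> w' w w'' /asboolP h /asboolP h'; apply/asboolP; exact: BraidTrans h h'.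
Qed.

Canonical braid_equiv :=
  EquivRel braid_relb braid_relb_refl braid_relb_sym braid_relb_trans.

Definition braid := {eq_quot braid_equiv}%qT.
HB.instance Definition _ := Choice.on braid.
HB.instance Definition _ := EqQuotient.on braid.

Definition braid_of (w : braid_word m) : braid := (\pi_braid w)%qT.

Lemma braid_ofP w w' : braid_of w = braid_of w' <-> braid_rel w w'.
Proof.
by split=> [/eqquotP/asboolP|h]; last by apply/eqquotP/asboolP.
Qed.

Lemma braid_ofK (a : braid) : braid_of (repr a) = a.
Proof. exact: reprK. Qed.

Definition word_inv w : braid_word m := rev [seq (l.1, ~~ l.2) | l <- w].

Lemma word_inv_cat w w' : word_inv (w ++ w') = word_inv w' ++ word_inv w.
Proof. by rewrite /word_inv map_cat rev_cat. Qed.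

Lemma word_invK : involutive word_inv.
Proof.
move=> w; rewrite /word_inv map_rev revK -map_comp map_id_in // => -[k b] _ /=.
by rewrite negbK.
Qed.

Lemma word_mulV w : braid_rel (w ++ word_inv w) [::].
Proof.
elim: w => [|[k b] w IHw]; first exact: BraidRefl.
rewrite -cat1s word_inv_cat -catA (catA w).
apply: BraidTrans (BraidCancel k b).
rewrite -[X in braid_rel _ X]/([:: (k, b)] ++ [::] ++ [:: (k, ~~ b)]).
by apply: BraidCat (BraidRefl _) (BraidCat IHw (BraidRefl _)).
Qed.

Definition braid_mul (a b : braid) := braid_of (repr a ++ repr b).
Definition braid_inv (a : braid) := braid_of (word_inv (repr a)).

Lemma braid_mulE w w' : braid_mul (braid_of w) (braid_of w') = braid_of (w ++ w').
Proof. by apply/braid_ofP/BraidCat; apply/braid_ofP; rewrite braid_ofK. Qed.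

Lemma braid_mulA : associative braid_mul.
Proof.
move=> a b c; rewrite -(braid_ofK a) -(braid_ofK b) -(braid_ofK c).
by rewrite !braid_mulE catA.
Qed.

Lemma braid_mul1 : left_id (braid_of [::]) braid_mul.
Proof. by move=> a; rewrite -(braid_ofK a) braid_mulE. Qed.

Lemma braid_mulr1 : right_id (braid_of [::]) braid_mul.
Proof. by move=> a; rewrite -(braid_ofK a) braid_mulE cats0. Qed.

Lemma braid_mulV : right_inverse (braid_of [::]) braid_inv braid_mul.
Proof.
move=> a; rewrite -{1}(braid_ofK a) braid_mulE.
by apply/braid_ofP/word_mulV.
Qed.

Lemma braid_mulVl : left_inverse (braid_of [::]) braid_inv braid_mul.
Proof.
move=> a; rewrite -{2}(braid_ofK a) braid_mulE; apply/braid_ofP.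
by rewrite -{2}(word_invK (repr a)); exact: word_mulV.
Qed.

HB.instance Definition _ :=
  isGroup.Build braid braid_mulA braid_mul1 braid_mulr1 braid_mulVl braid_mulV.

Definition elementary_braid (k : 'I_m.-1) : braid := braid_of [:: (k, true)].

End BraidGroup.

Section Hurwitz.
Local Open Scope group_scope.
Context (m : nat) (G : groupType).
Implicit Types (k l : 'I_m.-1) (x : 'I_m -> G).

Lemma ord_pred_lt (k : 'I_m.-1) : (k < m)%N.
Proof. exact: leq_trans (ltn_ord k) (leq_pred m). Qed.

Lemma ord_pred_succ_lt (k : 'I_m.-1) : (k.+1 < m)%N.
Proof. by rewrite -ltn_predRL. Qed.

Definition pos1 k : 'I_m := Ordinal (ord_pred_lt k).
Definition pos2 k : 'I_m := Ordinal (ord_pred_succ_lt k).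

(** [(.., a, b, ..) |-> (.., a b a^-1, a, ..)], [a] and [b] being the entries
    [pos1 k] and [pos2 k], and the inverse of this map. *)
Definition hurwitz k x : 'I_m -> G := fun i =>
  if i == pos1 k then x (pos1 k) * x (pos2 k) * (x (pos1 k))^-1
  else if i == pos2 k then x (pos1 k) else x i.

Definition hurwitz_inv k x : 'I_m -> G := fun i =>
  if i == pos1 k then x (pos2 k)
  else if i == pos2 k then (x (pos2 k))^-1 * x (pos1 k) * x (pos2 k) else x i.

Definition letter_act (s : 'I_m.-1 * bool) x :=
  if s.2 then hurwitz s.1 x else hurwitz_inv s.1 x.

Definition word_act (w : braid_word m) x := foldr letter_act x w.

Definition braid_act (b : braid m) x := word_act (repr b) x.

Lemma pos21 k : (pos2 k == pos1 k) = false.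
Proof. by rewrite -val_eqE /= gtn_eqF. Qed.

Lemma letter_actK k b x : letter_act (k, b) (letter_act (k, ~~ b) x) = x.
Proof.
apply/funext => i; rewrite /letter_act /hurwitz /hurwitz_inv.
case: b => /=; rewrite !eqxx pos21.
- have [->|_] := eqVneq i (pos1 k); first by rewrite !mulgA mulgV mul1g mulgK.
  by have [->|_] := eqVneq i (pos2 k).
- have [->|_] := eqVneq i (pos1 k); first by [].
  have [->|_] := eqVneq i (pos2 k); last by [].
  by rewrite !mulgA mulVg mul1g -mulgA mulVg mulg1.
Qed.

Lemma word_act_rel w w' : braid_rel w w' -> word_act w =1 word_act w'.
Proof.
elim=> //= {w w'}.
- by move=> w w' _ IH x; rewrite IH.
- by move=> w1 w2 w3 _ IH _ IH' x; rewrite IH IH'.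
- by move=> w1 w1' w2 w2' _ IH _ IH' x; rewrite /word_act !foldr_cat -!/(word_act _ _) IH IH'.
- by move=> k b x; exact: letter_actK.
- move=> k l kl x; apply/funext => i; rewrite /word_act /= /letter_act /= /hurwitz.
  have E : [/\ (pos1 k == pos1 l) = false, (pos1 k == pos2 l) = false,
            (pos2 k == pos1 l) = false & (pos2 k == pos2 l) = false].
    have kl' : (k < l)%N := ltnW kl.
    by rewrite -!val_eqE /= eqSS !(ltn_eqF kl', ltn_eqF kl, ltn_eqF (ltnW (kl' : (k.+1 < l.+1)%N))).
  have [E1 E2 E3 E4] := E.
  rewrite ![pos1 l == pos1 k]eq_sym ![pos1 l == pos2 k]eq_sym.
  rewrite ![pos2 l == pos1 k]eq_sym ![pos2 l == pos2 k]eq_sym E1 E2 E3 E4.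
  have [->|_] := eqVneq i (pos1 k); first by rewrite E1 E2.
  by have [->|_] := eqVneq i (pos2 k); first by rewrite E3 E4.
- move=> k l kl x; apply/funext => i; rewrite /word_act /= /letter_act /= /hurwitz.
  have E0 : pos1 l = pos2 k by apply/val_inj; rewrite /= -kl.
  have E1 : (pos2 k == pos2 l) = false.
    by rewrite -val_eqE /= -kl ltn_eqF.
  have E2 : (pos1 k == pos2 l) = false.
    by rewrite -val_eqE /= -kl ltn_eqF // ltnW.
  rewrite !E0 ![pos2 l == pos1 k]eq_sym ![pos2 l == pos2 k]eq_sym E1 E2.
  rewrite ![pos1 k == pos2 k]eq_sym !pos21 !eqxx.
  have [->|_] := eqVneq i (pos1 k).
    by rewrite ![pos1 k == pos2 k]eq_sym !pos21 ?E2 !invgM !mulgA mulgVK mulgK.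
  by have [_|_] := eqVneq i (pos2 k); last case: (i == pos2 l).
Qed.

Lemma braid_act_of w x : braid_act (braid_of w) x = word_act w x.
Proof. by apply: word_act_rel; apply/braid_ofP; rewrite braid_ofK. Qed.

Lemma braid_act1 x : braid_act 1 x = x.
Proof. exact: braid_act_of. Qed.

Lemma braid_actM (a b : braid m) x :
  braid_act (a * b) x = braid_act a (braid_act b x).
Proof. by rewrite braid_act_of /word_act foldr_cat. Qed.

Lemma braid_act_elementary k x :
  braid_act (elementary_braid k) x = hurwitz k x.
Proof. exact: braid_act_of. Qed.

End Hurwitz.

(* Main.v *)
(** Since [rprod] is invariant under braids, so is the term built from [beta],
    and the forms [tau] vanish identically because [Ad p] is an involution for
    [p] in [C].  There remains [omega_c].  For a map [f] into [G] let
    [L f = f^-1 df] and [R f = df f^-1] be its logarithmic derivatives, so that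
    the pullback of [Omega] by [(f, k)] is half the antisymmetrization of
    [L f . R k].  An elementary braid replaces the entries [a], [b] by
    [c = a b a^-1], [a]; with [P] the product of the preceding entries, the sum
    [L P . R a + L (P a) . R b] changes by [L c . R a - L a . R b].  Tangency to
    [C] and [Ad b ^ 2 = 1] give [R b = - L b], which makes this difference
    symmetric, so that its antisymmetrization is zero. *)

From HB Require Import structures.
Require Import Defs.
From mathcomp Require Import all_boot all_order all_algebra.
From mathcomp Require Import all_classical all_reals all_analysis.
From mathcomp Require Import ring.

Set Implicit Arguments.
Unset Strict Implicit.
Unset Printing Implicit Defensive.

Import Order.TTheory GRing.Theory Num.Theory.
Import numFieldNormedType.Exports.

Local Open Scope classical_set_scope.
Local Open Scope ring_scope.

(** * Maps of class [C^k] *)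

Section Calculus.
Context {R : realType}.
Implicit Types E F H : normedModType R.

(** The first-order expansion of [g] at [x] is also one of [f], because the two maps agree near [x];
    uniqueness of the differential then identifies ['d f x]. *)
Lemma near_is_diff E F (f g dg : E -> F) (x : E) :
  (\forall y \near x, f y = g y) -> is_diff x g dg -> is_diff x f dg.
Proof.
move=> fg [dg1 dg2].
have fgx := nbhs_singleton fg.
have key : f \o shift x = cst (f x) + 'd g x +o_ 0 id.
  apply/eqaddoP => e e0.
  have /eqaddoP/(_ e e0) H := diff_locally dg1.
  have fg0 : \forall h \near 0, f (h + x) = g (h + x).
    by move: fg; rewrite (near_shift 0) subr0.
  near=> h; have -> : (f \o shift x - (cst (f x) + 'd g x)) h =
    (g \o shift x - (cst (g x) + 'd g x)) h.
    by rewrite /= !fctE /= fgx; congr (_ - _); near: h.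
  by near: h.
have dE := diff_unique (diff_continuous dg1) key.
split; last by rewrite dE.
by apply/diff_locallyP; rewrite dE; split => //; exact: diff_continuous.
Unshelve. all: by end_near. Qed.

Lemma near_diff E F (f g : E -> F) (x : E) :
  (\forall y \near x, f y = g y) -> differentiable g x ->
  differentiable f x /\ 'd f x = 'd g x :> (E -> F).
Proof. by move=> fg /differentiableP /(near_is_diff fg) []. Qed.

Lemma CkW E F k (D : set E) (f : E -> F) : Ck k.+1 D f -> Ck k D f.
Proof.
elim: k f => [|k IH] f /=.
  by move=> [df _] x Dx; apply: differentiable_continuous; exact: df.
by move=> [df ddf]; split=> // v; exact/IH/ddf.
Qed.

Lemma Ck_subset E F k (D D' : set E) (f : E -> F) :
  D' `<=` D -> Ck k D f -> Ck k D' f.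
Proof.
move=> DD'; elim: k f => [|k IH] f /=; first by move=> cf x /DD'; exact: cf.
by move=> [df ddf]; split=> [x /DD'|v]; [exact: df | exact/IH/ddf].
Qed.

(** Differentials depend on germs only, so on the open set [D] the two maps have equal directional
    derivatives and the induction continues with these. *)
Lemma Ck_eq E F k (D : set E) (f g : E -> F) : open D ->
  {in D, f =1 g} -> Ck k D g -> Ck k D f.
Proof.
move=> oD; elim: k f g => [|k IH] f g fg.
  move=> cg x Dx.
  have fgx : {near nbhs x, g =1 f}.
    by near=> y; rewrite fg// inE; near: y; exact: open_nbhs_nbhs.
  rewrite /prop_for /continuous_at fg ?inE//.
  by apply: cvg_trans (cg x Dx); exact: near_eq_cvg.
move=> [dg ddg]; have fgx x : D x -> \forall y \near x, f y = g y.
  by move=> Dx; near=> y; rewrite fg// inE; near: y; exact: open_nbhs_nbhs.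
split=> [x Dx|v]; first by have [] := near_diff (fgx x Dx) (dg x Dx).
apply: IH (ddg v) => x; rewrite inE => Dx.
by have [_ ->] := near_diff (fgx x Dx) (dg x Dx).
Unshelve. all: by end_near. Qed.

Lemma Ck_cst E F k (D : set E) (c : F) : Ck k D (fun=> c).
Proof.
elim: k c => [|k IH] c /=; first by move=> x _; exact: cst_continuous.
split=> [x _|v]; first exact: differentiable_cst.
suff -> : (fun x => 'd (fun _ : E => c) x v) = fun=> 0 by exact: IH.
by apply/funext => x; rewrite diff_cst.
Qed.

Lemma Ck_linear E F k (D : set E) (f : {linear E -> F}) :
  continuous f -> Ck k D f.
Proof.
move=> cf; case: k => [|k] /=; first by move=> x _; exact: cf.
split=> [x _|v]; first exact: linear_differentiable.
suff -> : (fun x => 'd f x v) = fun=> f v by exact: Ck_cst.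
by apply/funext => x; rewrite diff_lin.
Qed.

Lemma CkD E F k (D : set E) (f g : E -> F) : open D ->
  Ck k D f -> Ck k D g -> Ck k D (fun x => f x + g x).
Proof.
move=> oD; elim: k f g => [|k IH] f g.
  by move=> cf cg x Dx; apply: cvgD; [exact: cf | exact: cg].
move=> [df ddf] [dg ddg]; split=> [x Dx|v].
  by apply: differentiableD; [exact: df | exact: dg].
apply: Ck_eq (IH _ _ (ddf v) (ddg v)) => // x; rewrite inE => Dx.
by rewrite diffD //; [exact: df | exact: dg].
Qed.

Lemma Ck_sum E F k (D : set E) (I : Type) (s : seq I) (f : I -> E -> F) :
  open D -> (forall i, Ck k D (f i)) -> Ck k D (fun x => \sum_(i <- s) f i x).
Proof.
move=> oD Cf; elim: s => [|i s IH].
  by under eq_fun do rewrite big_nil; exact: Ck_cst.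
by under eq_fun do rewrite big_cons; apply: CkD.
Qed.

Fact scale_is_bilinear F :
  bilinear_for
    (GRing.Scale.Law.clone _ _ *:%R _) (GRing.Scale.Law.clone _ _ *:%R _)
    (@GRing.scale R F).
Proof.
split=> [u'|u] a x y /=.
- by rewrite scalerDl scalerA.
- by rewrite scalerDr !scalerA mulrC.
Qed.
HB.instance Definition _ (F : normedModType R) :=
  bilinear_isBilinear.Build R R F F _ _
    (@GRing.scale R F) (@scale_is_bilinear F).

(** The Leibniz rule: the product is the pair [(c, f)] followed by scaling, a continuous bilinear
    map. *)
Lemma is_diff_scale E F (c dc : E -> R) (f df : E -> F) (x : E) :
  is_diff x c dc -> is_diff x f df ->
  is_diff x (fun y => c y *: f y) (fun v => c x *: df v + dc v *: f x).
Proof.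
move=> hc hf.
have cs : continuous (fun p : R * F => p.1 *: p.2) by exact: scale_continuous.
have hs p : is_diff p (fun q : R * F => q.1 *: q.2)
    (fun q => p.1 *: q.2 + q.1 *: p.2).
  by apply: DiffDef; [exact: differentiable_bilin | rewrite diff_bilin].
exact: (is_diff_comp (is_diff_pair hc hf) (hs _)).
Qed.

Lemma CkZ E F k (D : set E) (c : E -> R) (f : E -> F) : open D ->
  Ck k D c -> Ck k D f -> Ck k D (fun x => c x *: f x).
Proof.
move=> oD; elim: k c f => [|k IH] c f.
  by move=> cc cf x Dx; apply: cvgZ; [exact: cc | exact: cf].
move=> Cc Cf; have [dc ddc] := Cc; have [df ddf] := Cf.
have hd x (Dx : D x) :=
  is_diff_scale (differentiableP (dc x Dx)) (differentiableP (df x Dx)).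
split=> [x Dx|v]; first by have [] := hd x Dx.
apply: (@Ck_eq _ _ _ _ _
  (fun x => c x *: ('d f x v : F) + ('d c x v : R) *: f x)) => //.
  by move=> x; rewrite inE => Dx; have [_ ->] := hd x Dx.
by apply: CkD => //; apply: IH; do ?[exact: ddc | exact: ddf | exact: CkW].
Qed.

(** Finite dimensionality, in the form in which it makes the partial
    derivatives of a composition a finite sum of products. *)
Definition has_coordinates F := exists (I : Type) (s : seq I) (e : I -> F)
  (l : I -> {linear F -> R}), (forall i, continuous (l i)) /\
  forall y, y = \sum_(i <- s) l i y *: e i.

Lemma Ck_comp_linear E F H k (D : set E) (f : E -> F) (l : {linear F -> H}) :
  open D -> continuous l -> Ck k D f -> Ck k D (fun x => l (f x)).
Proof.
move=> oD cl; elim: k f => [|k IH] f.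
  by move=> cf x Dx; apply: continuous_comp; [exact: cf | exact: cl].
move=> [df ddf].
have hd x (Dx : D x) : is_diff x (fun x => l (f x)) (l \o 'd f x).
  apply: is_diff_comp (differentiableP (df x Dx)) _.
  by apply: DiffDef; [exact: linear_differentiable | exact: diff_lin].
split=> [x Dx|v]; first by have [] := hd x Dx.
apply: Ck_eq (IH _ (ddf v)) => // x; rewrite inE => Dx.
by have [_ ->] := hd x Dx.
Qed.

(** The direction ['d f x v] varies with [x], whereas [Ck] speaks of derivatives in fixed
    directions. Expanding it along the vectors [e i] writes the derivative of the composition as a
    finite sum of products of maps of class [C^k]. *)
Lemma Ck_comp E F H k (D : set E) (W : set F) (f : E -> F) (g : F -> H) :
  has_coordinates F -> open D -> (forall x, D x -> W (f x)) ->
  Ck k D f -> Ck k W g -> Ck k D (g \o f).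
Proof.
move=> [I [s [e [l [cl le]]]]] oD DW; elim: k g => [|k IH] g.
  by move=> cf cg x Dx; apply: continuous_comp; [exact: cf | exact/cg/DW].
move=> Cf [dg ddg]; have [df ddf] := Cf.
split=> [x Dx|v].
  by apply: differentiable_comp; [exact: df | exact/dg/DW].
apply: (@Ck_eq _ _ _ _ _
  (fun x => \sum_(i <- s) l i ('d f x v) *: ('d g (f x) (e i) : H))) => //.
  move=> x; rewrite inE => Dx; rewrite diff_comp /=; [|exact: df|exact/dg/DW].
  rewrite {1}(le ('d f x v)) linear_sum.
  by apply: eq_bigr => i _; rewrite linearZ.
apply: Ck_sum => // i; apply: CkZ => //.
  exact: (Ck_comp_linear oD (cl i) (ddf v)).
by apply: (IH (fun y => 'd g y (e i))); [exact: CkW | exact: ddg].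
Qed.

End Calculus.

(** * Coordinates on matrix spaces and products *)

Section Coordinates.
Context {R : realType}.
Implicit Types E F H : normedModType R.

Lemma mx_linear_continuous m n F (f : {linear 'M[R]_(m, n) -> F}) :
  continuous f.
Proof.
have -> : f = (fun A => \sum_i \sum_j A i j *: f (delta_mx i j)) :> (_ -> _).
  apply/funext => A; rewrite {1}(matrix_sum_delta A) linear_sum.
  apply: eq_bigr => i _; rewrite linear_sum.
  by apply: eq_bigr => j _; rewrite linearZ.
(* Continuity is class [C^0], so the closure lemmas for sums and products apply. *)
suff /(_ _ I) : Ck 0 setT
  (fun A : 'M[R]_(m, n) => \sum_i \sum_j A i j *: f (delta_mx i j)) by [].
do 2![apply: Ck_sum => [|?]; first exact: openT].
apply: CkZ; first exact: openT.
  by move=> A _; exact: coord_continuous.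
exact: Ck_cst.
Qed.

Lemma has_coordinates_mx m n : has_coordinates 'M[R]_(m, n).
Proof.
have lin (ij : 'I_m * 'I_n) : linear (fun A : 'M[R]_(m, n) => A ij.1 ij.2 : R).
  by move=> a A B; rewrite !mxE.
pose l ij : {linear 'M[R]_(m, n) -> R} :=
  HB.pack (fun A : 'M[R]_(m, n) => A ij.1 ij.2 : R)
    (GRing.isLinear.Build _ _ _ _ _ (lin ij)).
exists ('I_m * 'I_n)%type, (index_enum _), (fun ij => delta_mx ij.1 ij.2), l.
split=> [ij|A]; first exact: coord_continuous.
by rewrite {1}(matrix_sum_delta A) pair_bigA.
Qed.

Lemma has_coordinates_pair E F :
  has_coordinates E -> has_coordinates F -> has_coordinates (E * F)%type.
Proof.
move=> [I [s [e [l [cl le]]]]] [J [t [e' [l' [cl' le']]]]].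
pose L (k : I + J) : {linear (E * F)%type -> R} :=
  match k with inl i => (l i \o fst)%FUN | inr j => (l' j \o snd)%FUN end.
exists (I + J)%type, (map inl s ++ map inr t),
  (fun k => match k with inl i => (e i, 0) | inr j => (0, e' j) end), L.
split=> [[i|j]|[y z]].
- by move=> p; apply: continuous_comp; [exact: cvg_fst | exact: cl].
- by move=> p; apply: continuous_comp; [exact: cvg_snd | exact: cl'].
rewrite big_cat !big_map /=.
have -> : (y, z) = (y, 0) + (0, z) :> (E * F)%type.
  by congr pair; rewrite /= ?addr0 ?add0r.
congr (_ + _).
  rewrite {1}(le y); elim: s {le} => [|i s IH]; first by rewrite !big_nil.
  by rewrite !big_cons -IH; congr pair; rewrite /= ?scaler0 ?addr0.
rewrite {1}(le' z); elim: t {le'} => [|i t IH]; first by rewrite !big_nil.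
by rewrite !big_cons -IH; congr pair; rewrite /= ?scaler0 ?addr0.
Qed.

Lemma Ck_pair E F H k (D : set E) (f : E -> F) (g : E -> H) : open D ->
  Ck k D f -> Ck k D g -> Ck k D (fun x => (f x, g x)).
Proof.
move=> oD; elim: k f g => [|k IH] f g.
  by move=> cf cg x Dx; apply: cvg_pair; [exact: cf | exact: cg].
move=> [df ddf] [dg ddg]; split=> [x Dx|v].
  by apply: differentiable_pair; [exact: df | exact: dg].
apply: Ck_eq (IH _ _ (ddf v) (ddg v)) => // x; rewrite inE => Dx.
by rewrite diff_pair //; [exact: df | exact: dg].
Qed.

(** The matrix is the sum over [i] of the column [delta_mx i 0] times the row [f i x], hence a sum
    of continuous linear images of maps of class [C^k]. *)
Lemma Ck_rows E m n k (D : set E) (f : 'I_m -> E -> 'rV[R]_n) : open D ->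
  (forall i, Ck k D (f i)) -> Ck k D (fun x => \matrix_(i, j) f i x 0 j).
Proof.
move=> oD Cf.
apply: (@Ck_eq _ _ _ _ _ _
  (fun x => \sum_i mulmx (delta_mx i (0 : 'I_1)) (f i x) : 'M[R]_(m, n))) => //.
  move=> x _; apply/matrixP => i j; rewrite mxE summxE (bigD1 i) //= big1.
    by rewrite addr0 mxE big_ord1 !mxE !eqxx mul1r.
  by move=> i' /negbTE i'i; rewrite mxE big_ord1 !mxE eq_sym i'i mul0r.
apply: Ck_sum => // i; apply: Ck_comp_linear (Cf i) => //.
exact: mx_linear_continuous.
Qed.

End Coordinates.

(** * Smooth maps between charted spaces *)

Section Charts.
Context {R : realType}.
Implicit Types E F H : normedModType R.

(** Collects the local facts about the chart centred at [x] on which the chain rule rests. They pass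
    from the factors to products and powers point by point, without mention of transition maps. *)
Definition regular_chart E (M : chartedType E) (x : M) := let c := chart_at x in
  [/\ \forall y \near x, chart_inv c (chart_fun c y) = y,
      chart_inv c (chart_fun c x) = x,
      nbhs x (chart_dom c),
      {for chart_fun c x, continuous (chart_inv c)} &
      \forall e \near chart_fun c x, chart_fun c (chart_inv c e) = e].

Lemma atlas_regular E (M : chartedType E) (x : M) :
  smooth_atlas M -> regular_chart x.
Proof.
move=> [/(_ x) [cx oD oI cK [_ ci]] _].
have nD : nbhs x (chart_dom (chart_at x)) by exact: open_nbhs_nbhs.
split=> //.
- by apply: filterS nD => y Dy; rewrite cK// inE.
- by rewrite cK// inE.
- exact: ci.
- have : nbhs (chart_fun (chart_at x) x)
      (chart_fun (chart_at x) @` chart_dom (chart_at x)).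
    by apply: open_nbhs_nbhs; split=> //; exists x.
  by apply: filterS => _ [y Dy <-]; rewrite cK// inE.
Qed.

Lemma regular_pair E F (M : chartedType E) (N : chartedType F) (x : M) (y : N) :
  regular_chart x -> regular_chart y -> regular_chart (x, y).
Proof.
move=> [a1 a2 a3 a4 a5] [b1 b2 b3 b4 b5]; split=> /=.
- near=> z; rewrite [RHS]surjective_pairing; congr pair; near: z.
    exact: (cvg_fst a1).
  exact: (cvg_snd b1).
- by rewrite a2 b2.
- by exists (chart_dom (chart_at x), chart_dom (chart_at y)).
- apply: cvg_pair.
    by apply: (continuous_comp (f := fst)) => //; exact: cvg_fst.
  by apply: (continuous_comp (f := snd)) => //; exact: cvg_snd.
- near=> z; rewrite [RHS]surjective_pairing; congr pair; near: z.
    exact: (cvg_fst a5).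
  exact: (cvg_snd b5).
Unshelve. all: by end_near. Qed.

Lemma proj_power_continuous m (M : topologicalType) (i : 'I_m) :
  continuous (fun x : power m M => x i).
Proof. exact: (@proj_continuous _ (fun=> M) i). Qed.

Lemma cvg_power m (M : topologicalType) (T : Type) (A : set_system T)
    (FA : Filter A) (f : T -> power m M) (x : power m M) :
  (forall i, (fun t => f t i) @ A --> x i) -> f @ A --> x.
Proof.
move=> fx; apply/cvg_sup => i U [_ [[V oV <-] Vx VU]].
apply: filterS VU _; apply: (fx i).
exact: open_nbhs_nbhs.
Qed.

Lemma regular_power m n (M : chartedType 'rV[R]_n) (x : power m M) :
  (forall i, regular_chart (x i)) -> regular_chart x.
Proof.
move=> rx.
have rowE (y z : power m M) i :
    row i (\matrix_(i, j) chart_fun (chart_at (z i)) (y i) 0 j) =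
    chart_fun (chart_at (z i)) (y i).
  by apply/rowP => j; rewrite !mxE.
have rowC i : continuous (row i : 'M[R]_(m, n) -> 'rV[R]_n).
  exact: mx_linear_continuous.
split=> /=.
- near=> y; apply/funext => i; rewrite rowE.
  have: forall i,
      chart_inv (chart_at (x i)) (chart_fun (chart_at (x i)) (y i)) = y i.
    near: y; apply: filter_forall => j.
    by have [h _ _ _ _] := rx j; exact: (@proj_power_continuous m M j x _ h).
  exact.
- by apply/funext => i; rewrite rowE; case: (rx i).
- suff : \forall y \near x, forall i, chart_dom (chart_at (x i)) (y i) by [].
  apply: (@filter_forall _ _ _ (nbhs x)) => j.
  by have [_ _ h _ _] := rx j; exact: (@proj_power_continuous m M j x _ h).
- apply: (cvg_power (nbhs_filter _)) => i.
  apply: continuous_comp; first exact: rowC.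
  by rewrite rowE; case: (rx i).
- near=> A; apply/row_matrixP => i; rewrite rowE.
  have: forall i, chart_fun (chart_at (x i))
      (chart_inv (chart_at (x i)) (row i A)) = row i A.
    near: A; apply: filter_forall => j.
    have [_ _ _ _ h] := rx j; rewrite -(rowE x x j) in h.
    exact: (rowC j _ _ h).
  exact.
Unshelve. all: by end_near. Qed.

End Charts.

(** * Smoothness and differentials at a point *)

Section SmoothMaps.
Context {R : realType}.
Implicit Types E F H : normedModType R.

(** This is the clause of [smooth_on] at a single point, so a proof of [smooth_on D f] applied to a
    point of [D] is a proof of it. *)
Definition smooth_at E F (M : chartedType E) (N : chartedType F) (f : M -> N)
    x :=
  {for x, continuous f} /\
  exists2 W, open_nbhs (chart_fun (chart_at x) x) W & Coo W (in_charts f x).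

Lemma smooth_at_differentiable E F (M : chartedType E) (N : chartedType F)
    (f : M -> N) x : smooth_at f x ->
  differentiable (in_charts f x) (chart_fun (chart_at x) x).
Proof. by move=> [_ [W [_ Wx] /(_ 1%N) [df _]]]; exact: df. Qed.

(** The inner [chart_inv] and [chart_fun] at [f x] are known to cancel only near [f x]; continuity
    of [f] keeps the argument there. *)
Lemma in_charts_comp E F H (M : chartedType E) (N : chartedType F)
    (P : chartedType H) (f : M -> N) (g : N -> P) x :
  regular_chart x -> regular_chart (f x) -> {for x, continuous f} ->
  \forall e \near chart_fun (chart_at x) x,
    in_charts (g \o f) x e = (in_charts g (f x) \o in_charts f x) e.
Proof.
move=> [_ kx _ ix _] [kf _ _ _ _] cf; near=> e; rewrite /in_charts /=.
congr (chart_fun _ (g _)); apply/esym; near: e.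
have : {for chart_fun (chart_at x) x, continuous (f \o chart_inv (chart_at x))}.
  by apply: continuous_comp => //; rewrite kx.
by rewrite /prop_for /continuous_at /= kx => /(_ _ kf).
Unshelve. all: by end_near. Qed.

Lemma in_charts_center E F (M : chartedType E) (N : chartedType F)
    (f : M -> N) x :
  regular_chart x ->
  in_charts f x (chart_fun (chart_at x) x) = chart_fun (chart_at (f x)) (f x).
Proof. by move=> [_ kx _ _ _]; rewrite /in_charts /= kx. Qed.

Lemma smooth_at_near E F (M : chartedType E) (N : chartedType F) (f : M -> N) x
    (W : set E) (h : E -> F) : {for x, continuous f} ->
  open_nbhs (chart_fun (chart_at x) x) W -> Coo W h ->
  (\forall e \near chart_fun (chart_at x) x, in_charts f x e = h e) ->
  smooth_at f x.
Proof.
move=> cf [oW Wx] Ch; rewrite /prop_near1 nbhsE => -[V [oV Vx] Vh]; split=> //.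
exists (V `&` W); first by split; [exact: openI | split].
move=> k; apply: Ck_eq (Ck_subset (@subIsetr _ V W) (Ch k)).
  exact: openI.
by move=> e; rewrite inE => -[/Vh].
Qed.

Section Composition.
Context E F H (M : chartedType E) (N : chartedType F) (P : chartedType H).
Variables (f : M -> N) (g : N -> P) (x : M).
Hypotheses (rx : regular_chart x) (rf : regular_chart (f x)).
Hypotheses (sf : smooth_at f x) (sg : smooth_at g (f x)).

Lemma smooth_at_comp : has_coordinates F -> smooth_at (g \o f) x.
Proof.
move=> cF; have df := smooth_at_differentiable sf.
have [cf [W [oW Wx] CW]] := sf; have [cg [V [oV Vx] CV]] := sg.
(* On a small open [D] the local expression of [f] stays in [V], where that of [g] is smooth. *)
have : nbhs (chart_fun (chart_at x) x) (in_charts f x @^-1` V).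
  apply: (differentiable_continuous df).
  by rewrite in_charts_center //; exact: open_nbhs_nbhs.
rewrite nbhsE => -[D [oD Dx] DV].
apply: (@smooth_at_near _ _ _ _ _ _ (W `&` D)
  (in_charts g (f x) \o in_charts f x)).
- exact: continuous_comp.
- by split; [exact: openI | split].
- move=> k; apply: (Ck_comp (W := V)) => //; first exact: openI.
  + by move=> y [_ /DV].
  + exact: Ck_subset (CW k).
- exact: in_charts_comp.
Qed.

Lemma mdiff_comp u : mdiff (g \o f) x u = mdiff g (f x) (mdiff f x u).
Proof.
have df := smooth_at_differentiable sf; have dg := smooth_at_differentiable sg.
have [cf _] := sf; rewrite -(in_charts_center f rx) in dg.
have [_ E1] :=
  near_diff (in_charts_comp g rx rf cf) (differentiable_comp df dg).
by rewrite /mdiff E1 diff_comp // in_charts_center.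
Qed.

End Composition.

Lemma mdiff_near E F (M : chartedType E) (N : chartedType F) (f : M -> N) x
    (h : {linear E -> F}) u : continuous h ->
  (\forall e \near chart_fun (chart_at x) x, in_charts f x e = h e) ->
  mdiff f x u = h u.
Proof.
move=> ch fh; have [_ e] := near_diff fh (linear_differentiable _ ch).
by rewrite /mdiff e diff_lin.
Qed.

Lemma mdiffD E F (M : chartedType E) (N : chartedType F) (f : M -> N) x u v :
  mdiff f x (u + v) = mdiff f x u + mdiff f x v.
Proof. exact: linearD. Qed.

Lemma mdiff0 E F (M : chartedType E) (N : chartedType F) (f : M -> N) x :
  mdiff f x 0 = 0.
Proof. exact: linear0. Qed.

Lemma mdiffN E F (M : chartedType E) (N : chartedType F) (f : M -> N) x u :
  mdiff f x (- u) = - mdiff f x u.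
Proof. exact: linearN. Qed.

Lemma smooth_at_cst E F (M : chartedType E) (N : chartedType F) (y : N)
    (x : M) :
  smooth_at (fun=> y) x.
Proof.
split; first exact: cst_continuous.
by exists setT; [split=> //; exact: openT | move=> k; exact: Ck_cst].
Qed.

Lemma mdiff_cst E F (M : chartedType E) (N : chartedType F) (y : N) (x : M) u :
  mdiff (fun=> y) x u = 0.
Proof. by rewrite /mdiff (diff_cst (chart_fun (chart_at y) y)). Qed.

Lemma smooth_at_id E (M : chartedType E) (x : M) :
  regular_chart x -> smooth_at (fun y : M => y) x.
Proof.
move=> [_ _ _ _ kx]; apply: (smooth_at_near (W := setT) (h := id)) => //.
- by split=> //; exact: openT.
- by move=> k; apply: (@Ck_linear _ E E k setT idfun) => ?.
Qed.

Lemma mdiff_id E (M : chartedType E) (x : M) u :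
  regular_chart x -> mdiff (fun y : M => y) x u = u.
Proof.
by move=> [_ _ _ _ kx]; apply: (mdiff_near (h := idfun)) => // ?.
Qed.

Section Pairing.
Context E F H (M : chartedType E) (N : chartedType F) (P : chartedType H).
Variables (f : M -> N) (g : M -> P) (x : M).
Hypotheses (sf : smooth_at f x) (sg : smooth_at g x).

Lemma smooth_at_pair : smooth_at (fun y => (f y, g y)) x.
Proof.
have [cf [W [oW Wx] CW]] := sf; have [cg [V [oV Vx] CV]] := sg.
split; first exact: cvg_pair.
exists (W `&` V); first by split; [exact: openI | split].
move=> k; apply: Ck_pair; first exact: openI.
  exact: Ck_subset (CW k).
exact: Ck_subset (CV k).
Qed.

Lemma mdiff_pair u :
  mdiff (fun y => (f y, g y)) x u = (mdiff f x u, mdiff g x u).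
Proof.
have df := smooth_at_differentiable sf; have dg := smooth_at_differentiable sg.
exact: (congr1 (@^~ u) (diff_pair df dg)).
Qed.

End Pairing.

Section Power.
Context (m n : nat) (M : chartedType 'rV[R]_n).

Lemma in_charts_proj (x : power m M) i : (forall i, regular_chart (x i)) ->
  \forall A \near chart_fun (chart_at x) x,
    in_charts (fun y : power m M => y i) x A = row i A.
Proof.
move=> /regular_power [_ _ _ _ kx]; near=> A.
rewrite /in_charts /=; apply/rowP => j; rewrite [RHS]mxE.
have /matrixP/(_ i j) : chart_fun (chart_at x) (chart_inv (chart_at x) A) = A.
  by near: A.
by rewrite mxE.
Unshelve. all: by end_near. Qed.

Lemma smooth_at_proj (x : power m M) i : (forall i, regular_chart (x i)) ->
  smooth_at (fun y : power m M => y i) x.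
Proof.
move=> rx; apply: smooth_at_near (in_charts_proj i rx).
- exact: proj_power_continuous.
- by split; [exact: openT|].
- by move=> k; apply: Ck_linear; exact: mx_linear_continuous.
Qed.

Lemma mdiff_proj (x : power m M) i A : (forall i, regular_chart (x i)) ->
  mdiff (fun y : power m M => y i) x A = row i A.
Proof.
move=> /(in_charts_proj i); apply: mdiff_near; exact: mx_linear_continuous.
Qed.

(** There are finitely many factors, so the neighbourhoods on which the coordinates of [f] are
    smooth contain a common open one. *)
Lemma smooth_at_power E (N : chartedType E) (f : N -> power m M) x :
  (forall i, smooth_at (fun y => f y i) x) -> smooth_at f x.
Proof.
move=> sf; split.
  by apply: (cvg_power (nbhs_filter _)) => i; case: (sf i).
have /choice [W hW] : forall i, exists W, open_nbhs (chart_fun (chart_at x) x) W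
    /\ Coo W (in_charts (fun y => f y i) x).
  by move=> i; have [_ [W]] := sf i; exists W.
have : \forall e \near chart_fun (chart_at x) x, forall i, W i e.
  apply: (@filter_forall _ _ _ (nbhs _)) => i.
  by apply: open_nbhs_nbhs; have [] := hW i.
rewrite /prop_near1 nbhsE => -[V oV VW]; exists V => // k.
apply: Ck_rows => [|i]; first by case: oV.
by have [_ /(_ k)] := hW i; apply: Ck_subset => y /VW.
Qed.

End Power.

End SmoothMaps.

(** * Logarithmic derivatives on a Lie group *)

(** Sealed: unification must not try to compare two derivatives by unfolding
    them. *)
HB.lock Definition adj (R : realType) (n : nat) (G : lieGroupType R n) (g : G)
  (X : 'rV[R]_n) : 'rV[R]_n := Ad g X.

HB.lock Definition dlogL (R : realType) (n : nat) (G : lieGroupType R n)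
    (E : normedModType R) (M : chartedType E) (x : M) (f : M -> G) (u : E) :
  'rV[R]_n := mcL (f x) (mdiff f x u).

HB.lock Definition dlogR (R : realType) (n : nat) (G : lieGroupType R n)
    (E : normedModType R) (M : chartedType E) (x : M) (f : M -> G) (u : E) :
  'rV[R]_n := mcR (f x) (mdiff f x u).

(** * The adjoint action and the Maurer-Cartan forms *)

Section LieCalculus.
Context {R : realType} {n : nat} {G : lieGroupType R n}.
Implicit Types (g h : G) (X Y : 'rV[R]_n).

Lemma regular_lie g : regular_chart g.
Proof. exact: atlas_regular lie_atlas. Qed.

Section SmoothProducts.
Context (E : normedModType R) (M : chartedType E) (x : M).
Hypothesis rx : regular_chart x.
Implicit Types (f k : M -> G) (u : E).

Lemma smooth_at_mulg f k : smooth_at f x -> smooth_at k x ->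
  smooth_at (fun y => (f y * k y)%g) x.
Proof.
move=> sf sk; apply: (smooth_at_comp (f := fun y => (f y, k y))
  (g := fun p : G * G => (p.1 * p.2)%g)) => //.
- by apply: regular_pair; exact: regular_lie.
- exact: smooth_at_pair.
- exact: smooth_mulg.
- by apply: has_coordinates_pair; exact: has_coordinates_mx.
Qed.

Lemma smooth_at_invg f : smooth_at f x -> smooth_at (fun y => (f y)^-1%g) x.
Proof.
move=> sf; apply: (smooth_at_comp (f := f) (g := fun g : G => g^-1%g)) => //.
- exact: regular_lie.
- exact: smooth_invg.
- exact: has_coordinates_mx.
Qed.

End SmoothProducts.

Lemma smooth_at_mulgl g h : smooth_at (fun y : G => (g * y)%g) h.
Proof.
apply: smooth_at_mulg; [exact: regular_lie | exact: smooth_at_cst |].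
exact/smooth_at_id/regular_lie.
Qed.

Lemma smooth_at_mulgr g h : smooth_at (fun y : G => (y * g)%g) h.
Proof.
apply: smooth_at_mulg; [exact: regular_lie | | exact: smooth_at_cst].
exact/smooth_at_id/regular_lie.
Qed.

Lemma smooth_at_conjg g h : smooth_at (fun y : G => (g * y * g^-1)%g) h.
Proof.
apply: smooth_at_mulg; [exact: regular_lie | | exact: smooth_at_cst].
exact: smooth_at_mulgl.
Qed.

(** The base point of the outer differential is a variable [h] with a proof of [f g = h], since
    points such as [g^-1 * g] equal [1] only propositionally. *)
Lemma mdiff_compG (f k : G -> G) g h X : f g = h ->
  smooth_at f g -> smooth_at k h ->
  mdiff k h (mdiff f g X) = mdiff (fun y => k (f y)) g X.
Proof. by move=> <- sf sk; rewrite -mdiff_comp //; exact: regular_lie. Qed.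

Lemma eq_mdiff (f k : G -> G) g X : f =1 k -> mdiff f g X = mdiff k g X.
Proof. by move=> /funext ->. Qed.

Lemma mdiff_idG g X : mdiff (fun h : G => h) g X = X.
Proof. exact/mdiff_id/regular_lie. Qed.

Definition mulp (p : G * G) : G := (p.1 * p.2)%g.

Lemma smooth_at_mulp p : smooth_at mulp p.
Proof. exact: smooth_mulg. Qed.

Lemma mdiff_mulpl g h X :
  mdiff mulp (g, h) (X, 0) = mdiff (fun y : G => (y * h)%g) g X.
Proof.
have si : smooth_at (fun y : G => y) g by exact/smooth_at_id/regular_lie.
have sc : smooth_at (fun=> h) g by exact: smooth_at_cst.
have <- : mdiff (mulp \o (fun y => (y, h))) g X =
  mdiff (fun y : G => (y * h)%g) g X by [].
rewrite mdiff_comp ?mdiff_pair ?mdiff_idG ?mdiff_cst //.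
- exact: regular_lie.
- by apply: regular_pair; exact: regular_lie.
- exact: smooth_at_pair.
- exact: smooth_at_mulp.
Qed.

Lemma mdiff_mulpr g h X :
  mdiff mulp (g, h) (0, X) = mdiff (fun y : G => (g * y)%g) h X.
Proof.
have si : smooth_at (fun y : G => y) h by exact/smooth_at_id/regular_lie.
have sc : smooth_at (fun=> g) h by exact: smooth_at_cst.
have <- : mdiff (mulp \o (fun y => (g, y))) h X =
  mdiff (fun y : G => (g * y)%g) h X by [].
rewrite mdiff_comp ?mdiff_pair ?mdiff_idG ?mdiff_cst //.
- exact: regular_lie.
- by apply: regular_pair; exact: regular_lie.
- exact: smooth_at_pair.
- exact: smooth_at_mulp.
Qed.

Lemma adjE g X : Ad g X = adj g X.
Proof. by rewrite unlock. Qed.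

Lemma adjD g X Y : adj g (X + Y) = adj g X + adj g Y.
Proof. by rewrite unlock; exact: mdiffD. Qed.

Lemma adjN g X : adj g (- X) = - adj g X.
Proof. by rewrite unlock; exact: mdiffN. Qed.

Lemma adjB g X Y : adj g (X - Y) = adj g X - adj g Y.
Proof. by rewrite adjD adjN. Qed.

(** As [f] sends [g] to the identity, its differential takes values in the Lie algebra and [Ad h]
    can follow it. The chain rule then reduces identities between [adj], [mcL] and [mcR] to
    identities between maps [G -> G]. *)
Lemma adj_mdiff (f : G -> G) g h X : f g = 1%g -> smooth_at f g ->
  adj h (mdiff f g X) = mdiff (fun y => (h * f y * h^-1)%g) g X.
Proof.
move=> fg sf; rewrite unlock; apply: mdiff_compG => //.
exact: smooth_at_conjg.
Qed.

Lemma adjM g h X : adj (g * h)%g X = adj g (adj h X).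
Proof.
rewrite -[adj h X]adjE /Ad adj_mdiff; [|by rewrite mulg1 mulgV|];
  last exact: smooth_at_conjg.
by rewrite -adjE /Ad; apply: eq_mdiff => y; rewrite invgM !mulgA.
Qed.

Lemma adj_central g X : (forall h, commute g h) -> adj g X = X.
Proof.
move=> cg; rewrite -adjE /Ad -[RHS](mdiff_idG 1%g); apply: eq_mdiff => y.
by rewrite cg mulgK.
Qed.

Lemma adj1 X : adj (1%g : G) X = X.
Proof. by apply: adj_central => h; rewrite /commute mul1g mulg1. Qed.

Lemma adjK g X : adj g (adj g^-1%g X) = X.
Proof. by rewrite -adjM mulgV adj1. Qed.

Lemma adjVK g X : adj g^-1%g (adj g X) = X.
Proof. by rewrite -adjM mulVg adj1. Qed.

Lemma mcLD g X Y : mcL g (X + Y) = mcL g X + mcL g Y.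
Proof. exact: mdiffD. Qed.

Lemma mcRD g X Y : mcR g (X + Y) = mcR g X + mcR g Y.
Proof. exact: mdiffD. Qed.

Lemma mcRN g X : mcR g (- X) = - mcR g X.
Proof. exact: mdiffN. Qed.

(** Differentiate [g (g^-1 y) g^-1 = y g^-1] at [y = g]. *)
Lemma mcR_adj g X : mcR g X = adj g (mcL g X).
Proof.
rewrite /mcL adj_mdiff; [|exact: mulVg|exact: smooth_at_mulgl].
by rewrite /mcR; apply: eq_mdiff => y; rewrite !mulgA mulgV mul1g.
Qed.

Lemma mcL_mulgr g h X :
  mcL (g * h)%g (mdiff (fun y : G => (y * h)%g) g X) = adj h^-1%g (mcL g X).
Proof.
rewrite [mcL g X]/mcL adj_mdiff; [|exact: mulVg|exact: smooth_at_mulgl].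
rewrite /mcL (@mdiff_compG (fun y => (y * h)%g));
  [|by []|exact: smooth_at_mulgr|exact: smooth_at_mulgl].
by apply: eq_mdiff => y; rewrite invgM invgK !mulgA.
Qed.

Lemma mcL_mulgl g h X :
  mcL (g * h)%g (mdiff (fun y : G => (g * y)%g) h X) = mcL h X.
Proof.
rewrite /mcL (@mdiff_compG (fun y => (g * y)%g));
  [|by []|exact: smooth_at_mulgl..].
by apply: eq_mdiff => y; rewrite invgM !mulgA mulgVK.
Qed.

Lemma mcR_rtrans X g : mcR g (rtrans X g) = X.
Proof.
rewrite /mcR /rtrans (@mdiff_compG (fun y => (y * g)%g));
  [|exact: mul1g|exact: smooth_at_mulgr..].
by rewrite -[RHS](mdiff_idG 1%g); apply: eq_mdiff => y; rewrite mulgK.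
Qed.

Lemma mcR_ltrans X g : mcR g (ltrans g X) = Ad g X.
Proof.
rewrite /mcR /ltrans (@mdiff_compG (fun y => (g * y)%g));
  [by []|exact: mulg1|exact: smooth_at_mulgl|exact: smooth_at_mulgr].
Qed.

Lemma rtrans_mcR X g : rtrans (mcR g X) g = X.
Proof.
rewrite /rtrans /mcR (@mdiff_compG (fun y => (y * g^-1)%g));
  [|exact: mulgV|exact: smooth_at_mulgr..].
by rewrite -[RHS](mdiff_idG g); apply: eq_mdiff => y; rewrite mulgVK.
Qed.

Lemma rtransB X Y g : rtrans (X - Y) g = rtrans X g - rtrans Y g.
Proof. by rewrite /rtrans mdiffD mdiffN. Qed.

Lemma mcR_orbit_vec Y g : mcR g (orbit_vec Y g) = Y - adj g Y.
Proof.
rewrite /orbit_vec mcRD mcRN [X in X - _]mcR_rtrans [X in _ - X]mcR_ltrans.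
by rewrite adjE.
Qed.

Lemma rtrans_adj Y g : rtrans (adj g Y) g = ltrans g Y.
Proof. by rewrite -adjE -mcR_ltrans; exact: rtrans_mcR. Qed.

(** Right translation identifies the tangent space at [g] with the Lie algebra and the tangent space
    of the conjugacy class with the image of [1 - Ad g]. Tangency is used in this form from here
    on. *)
Lemma orbit_vecP g X :
  (exists Y, X = orbit_vec Y g) <-> (exists Y, mcR g X = Y - adj g Y).
Proof.
split=> -[Y XY]; exists Y; first by rewrite XY mcR_orbit_vec.
by rewrite -[LHS](rtrans_mcR _ g) XY rtransB [X in _ - X]rtrans_adj.
Qed.

(** * Product, inverse and conjugation rules for logarithmic derivatives *)

Section LogarithmicDerivatives.
Context (E : normedModType R) (M : chartedType E) (x : M).
Hypothesis rx : regular_chart x.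
Implicit Types (f k : M -> G) (u : E).

Lemma dlogR_adj f u : dlogR x f u = adj (f x) (dlogL x f u).
Proof. by rewrite [dlogR]unlock [dlogL]unlock; exact: mcR_adj. Qed.

(** The product is [mulp] after the pair [(f, k)], whose tangent vector splits into one part for
    each factor; right translation by [k x] twists the first part by the adjoint action of its
    inverse. *)
Lemma dlogL_mulg f k u : smooth_at f x -> smooth_at k x ->
  dlogL x (fun y => (f y * k y)%g) u =
  adj (k x)^-1%g (dlogL x f u) + dlogL x k u.
Proof.
move=> sf sk; rewrite [dlogL]unlock.
have -> : mdiff (fun y => (f y * k y)%g) x u =
  mdiff (mulp \o (fun y => (f y, k y))) x u by [].
rewrite mdiff_comp ?mdiff_pair //; first last.
- exact: smooth_at_mulp.
- exact: smooth_at_pair.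
- by apply: regular_pair; exact: regular_lie.
have -> : (mdiff f x u, mdiff k x u) = (mdiff f x u, 0) + (0, mdiff k x u).
  by congr pair; rewrite /= ?addr0 ?add0r.
rewrite mdiffD mdiff_mulpl mdiff_mulpr mcLD.
by rewrite [X in X + _]mcL_mulgr [X in _ + X]mcL_mulgl.
Qed.

Lemma dlogL_cst g u : dlogL x (fun=> g) u = 0.
Proof. by rewrite [dlogL]unlock mdiff_cst; exact: mdiff0. Qed.

Lemma dlogR_mulg f k u : smooth_at f x -> smooth_at k x ->
  dlogR x (fun y => (f y * k y)%g) u = dlogR x f u + adj (f x) (dlogR x k u).
Proof.
by move=> sf sk; rewrite !dlogR_adj dlogL_mulg // adjM !adjD adjK.
Qed.

(** Differentiate the constant product [f f^-1] by [dlogL_mulg]. *)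
Lemma dlogL_invg f u : smooth_at f x ->
  dlogL x (fun y => (f y)^-1%g) u = - dlogR x f u.
Proof.
move=> sf; have sV := smooth_at_invg rx sf; apply/eqP.
rewrite -addr_eq0 addrC dlogR_adj -{1}[f x]invgK -dlogL_mulg //.
by under [X in dlogL _ X]eq_fun do rewrite mulgV; rewrite dlogL_cst.
Qed.

Lemma dlogR_conjg f k u : smooth_at f x -> smooth_at k x ->
  dlogR x (fun y => (f y * k y * (f y)^-1)%g) u =
  dlogR x f u + adj (f x) (dlogR x k u)
  - adj (f x * k x * (f x)^-1)%g (dlogR x f u).
Proof.
move=> sf sk; have sV := smooth_at_invg rx sf.
rewrite dlogR_mulg ?dlogR_mulg //; last exact: smooth_at_mulg.
by rewrite [dlogR x (fun=> _^-1%g) u]dlogR_adj dlogL_invg // -adjM adjN.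
Qed.

(** If [R k = Y - Ad k Y], the witness for [f k f^-1] is [R f + Ad f Y], because
    [Ad (f k f^-1) Ad f = Ad (f k)]. This is why Hurwitz moves preserve tangency. *)
Lemma dlogR_conjg_orbit f k u : smooth_at f x -> smooth_at k x ->
  (exists Y, dlogR x k u = Y - adj (k x) Y) ->
  exists Y, dlogR x (fun y => (f y * k y * (f y)^-1)%g) u =
    Y - adj (f x * k x * (f x)^-1)%g Y.
Proof.
move=> sf sk [Y kY]; exists (dlogR x f u + adj (f x) Y).
by rewrite dlogR_conjg // kY adjB !adjD -!adjM mulgVK opprD !addrA [LHS]addrAC.
Qed.

End LogarithmicDerivatives.

End LieCalculus.

(** * Invariant inner products, [tau] and the pullbacks of [Omega] *)

Section InvariantForms.
Context {R : realType} {n : nat} {G : lieGroupType R n}.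
Variable dot : 'rV[R]_n -> 'rV[R]_n -> R.
Hypothesis dotP : invariant_inner_product G dot.
Implicit Types (g h : G) (X Y Z : 'rV[R]_n).

Lemma dotDl X Y Z : dot (X + Y) Z = dot X Z + dot Y Z.
Proof. by rewrite -[X in LHS]scale1r (dot_linear dotP) mul1r. Qed.

Lemma dot0l X : dot 0 X = 0.
Proof. by apply: (addrI (dot 0 X)); rewrite -dotDl !addr0. Qed.

Lemma dotNl X Y : dot (- X) Y = - dot X Y.
Proof. by apply/eqP; rewrite -addr_eq0 -dotDl addNr dot0l. Qed.

Lemma dotDr X Y Z : dot X (Y + Z) = dot X Y + dot X Z.
Proof. by rewrite !(dot_sym dotP X) dotDl. Qed.

Lemma dot0r X : dot X 0 = 0.
Proof. by rewrite (dot_sym dotP) dot0l. Qed.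

Lemma dotNr X Y : dot X (- Y) = - dot X Y.
Proof. by rewrite !(dot_sym dotP X) dotNl. Qed.

Lemma dot_adj g X Y : dot (adj g X) (adj g Y) = dot X Y.
Proof. by rewrite -!adjE (dot_Ad dotP). Qed.

Lemma dot_adjl g X Y : dot (adj g X) Y = dot X (adj g^-1%g Y).
Proof. by rewrite -{1}[Y](adjK g) dot_adj. Qed.

Lemma adj_involutive g : (forall h, commute (g ^+ 2)%g h) -> involutive (adj g).
Proof. by move=> cg X; rewrite -adjM; exact: adj_central. Qed.

Lemma adj_involutiveV g X : involutive (adj g) -> adj g^-1%g X = adj g X.
Proof. by move=> gg; rewrite -{1}[X]gg adjVK. Qed.

(** By invariance the adjoint of [Ad g] is its inverse, here [Ad g] itself, so the two terms of
    [tau] cancel. *)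
Lemma tau_involutive g u v : involutive (adj g) -> tau dot g u v = 0.
Proof.
(* When no representatives [X] and [Y] exist, [xget] returns its default [0], which agrees with the
   claim. *)
move=> gg; rewrite /tau; case: xgetP => // t _ [X [Y [_ _ ->]]].
rewrite !adjE [dot Y _](dot_sym dotP) dot_adjl adj_involutiveV //.
by rewrite subrr mulr0.
Qed.

Section PulledBack.
Context (E : normedModType R) (M : chartedType E) (x : M).
Hypothesis rx : regular_chart x.
Implicit Types (f k P a b : M -> G) (A B : E).

(** Twice the pullback of [Omega] by [(f, k)] when both maps are smooth at [x], as [pullback_Omega]
    shows. *)
Definition dlog_form f k A B :=
  dot (dlogL x f A) (dlogR x k B) - dot (dlogR x k A) (dlogL x f B).

Lemma eq_dlog_form f f' k k' A B : f =1 f' -> k =1 k' ->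
  dlog_form f k A B = dlog_form f' k' A B.
Proof. by move=> /funext -> /funext ->. Qed.

Lemma pullback_Omega f k A B : smooth_at f x -> smooth_at k x ->
  pullback2 (fun y => (f y, k y)) (Omega dot) x A B = 2^-1 * dlog_form f k A B.
Proof.
move=> sf sk; rewrite /pullback2 /Omega !mdiff_pair //.
by rewrite /dlog_form [dlogL]unlock [dlogR]unlock.
Qed.

Lemma dlog_form_cst g k A B : dlog_form (fun=> g) k A B = 0.
Proof. by rewrite /dlog_form !dlogL_cst dot0l dot0r subrr. Qed.

(** The conjugations by [a] cancel, because the inner product is invariant;
    what remains is symmetric in [A] and [B] as soon as [Ad b] is an
    involution, since then [b^-1 db = - db b^-1] on the conjugacy class. *)
Lemma dlog_form_conjg P a b A B (c := fun y => (a y * b y * (a y)^-1)%g) :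
  smooth_at P x -> smooth_at a x -> smooth_at b x -> involutive (adj (b x)) ->
  (exists Y, dlogR x b A = Y - adj (b x) Y) ->
  (exists Y, dlogR x b B = Y - adj (b x) Y) ->
  dlog_form P c A B + dlog_form (fun y => (P y * c y)%g) a A B =
  dlog_form P a A B + dlog_form (fun y => (P y * a y)%g) b A B.
Proof.
move=> sP sa sb bb bA bB.
have saV := smooth_at_invg rx sa; have sab := smooth_at_mulg rx sa sb.
have sc : smooth_at c x by exact: smooth_at_mulg.
pose s f k A B := dot (dlogL x f A) (dlogR x k B).
(* [D] is the change of the sum before antisymmetrization; the goal is to show it symmetric. *)
pose D A B := dot (dlogL x c A) (dlogR x a B) - dot (dlogL x a A) (dlogR x b B).
have key A' B' : s P c A' B' + s (fun y => (P y * c y)%g) a A' B' =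
    s P a A' B' + s (fun y => (P y * a y)%g) b A' B' + D A' B'.
  rewrite /s /D !dlogL_mulg // [in LHS]dlogR_conjg //.
  rewrite !(dotDl, dotDr, dotNr) !(dot_adjl, invgK) /c; ring.
(* The involution gives [Ad b (R b) = L b], while [Ad b] sends [Y - Ad b Y] to its negative. *)
have LE A' : (exists Y, dlogR x b A' = Y - adj (b x) Y) ->
    dlogR x b A' = - dlogL x b A'.
  move=> [Y bY]; have : adj (b x) (dlogR x b A') = dlogL x b A'.
    by rewrite dlogR_adj bb.
  by move=> <-; rewrite bY adjB bb opprB.
(* Expanding [L c] for [c = (a b) a^-1] leaves four terms: the first is symmetric because [Ad b] is
   self-adjoint, the next two are exchanged by swapping the arguments, and the last is symmetric. *)
have DE A' B' : (exists Y, dlogR x b B' = Y - adj (b x) Y) ->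
    D A' B' = dot (adj (b x) (dlogL x a A')) (dlogL x a B')
      + dot (dlogL x b A') (dlogL x a B') + dot (dlogL x a A') (dlogL x b B')
      - dot (dlogL x a A') (dlogL x a B').
  move=> tB; rewrite /D (LE _ tB) !dlogL_mulg // dlogL_invg // invgK.
  rewrite !dlogR_adj adj_involutiveV // dotDl dotNl !dot_adj dotDl dotNr; ring.
have Dsym : D A B = D B A.
  rewrite !DE // [in RHS]dot_adjl adj_involutiveV //.
  rewrite ![dot (dlogL x _ B) _](dot_sym dotP) [dot (adj _ _) _](dot_sym dotP).
  by rewrite [dot _ (adj _ _)](dot_sym dotP); ring.
have sE f k : dlog_form f k A B = s f k A B - s f k B A.
  by rewrite /dlog_form /s [dot (dlogR _ _ _) _](dot_sym dotP).
rewrite !sE; have := key A B; have := key B A; rewrite Dsym => e1 e2.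
rewrite addrACA -opprD e1 e2; ring.
Qed.

End PulledBack.
End InvariantForms.

(** * The braid action *)

Section PowerOfGroup.
Context {R : realType} {n : nat} {G : lieGroupType R n} {m : nat}.
Implicit Types (x y : power m G) (A B : 'M[R]_(m, n)) (k : 'I_m.-1).

Lemma regular_power_lie x : regular_chart x.
Proof. by apply: regular_power => i; exact: regular_lie. Qed.

Lemma smooth_at_coord x i : smooth_at (fun y : power m G => y i) x.
Proof. by apply: smooth_at_proj => j; exact: regular_lie. Qed.

Lemma mdiff_coord x i A : mdiff (fun y : power m G => y i) x A = row i A.
Proof. by apply: mdiff_proj => j; exact: regular_lie. Qed.

Lemma dlogL_comp (f : power m G -> power m G) (h : power m G -> G) x A :
  smooth_at f x -> smooth_at h (f x) ->
  dlogL (f x) h (mdiff f x A) = dlogL x (fun y => h (f y)) A.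
Proof.
move=> sf sh; rewrite [dlogL]unlock -(mdiff_comp (g := h)) //;
  exact: regular_power_lie.
Qed.

Lemma dlogR_comp (f : power m G -> power m G) (h : power m G -> G) x A :
  smooth_at f x -> smooth_at h (f x) ->
  dlogR (f x) h (mdiff f x A) = dlogR x (fun y => h (f y)) A.
Proof. by move=> sf sh; rewrite !dlogR_adj dlogL_comp. Qed.

(** Moves tangency to the logarithmic derivatives of the coordinates, which obey the chain and
    product rules. *)
Lemma tangent_classP x A : tangent_class x A <->
  forall i, exists Y, dlogR x (fun y => y i) A = Y - adj (x i) Y.
Proof.
split=> tA i; have := tA i; rewrite orbit_vecP [dlogR]unlock mdiff_coord //.
Qed.

(** The first component of [Epair j], for any natural number [j], so that [prefix_prod m] is the
    whole product. *)
Definition prefix_prod (j : nat) x : G := \big[*%g/1%g]_(i < m | (i < j)%N) x i.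

Lemma prefix_prod0 x : prefix_prod 0 x = 1%g.
Proof. by rewrite /prefix_prod big_pred0. Qed.

Lemma prefix_prodS (j : 'I_m) x :
  prefix_prod j.+1 x = (prefix_prod j x * x j)%g.
Proof.
rewrite /prefix_prod (big_ord_narrow (ltn_ord j)) big_ord_recr /=.
rewrite (big_ord_narrow (ltnW (ltn_ord j))); congr (_ * x _)%g.
  by apply: eq_bigr => i _; congr (x _); exact: val_inj.
exact: val_inj.
Qed.

Lemma prefix_prod_rprod x : prefix_prod m x = rprod x.
Proof. by apply: eq_bigl => i; rewrite ltn_ord. Qed.

Lemma smooth_at_prefix_prod j x : (j <= m)%N -> smooth_at (prefix_prod j) x.
Proof.
elim: j => [_|j IH jm].
  by rewrite (_ : prefix_prod 0 = fun=> 1%g);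
    [exact: smooth_at_cst | exact/funext/prefix_prod0].
rewrite (_ : prefix_prod j.+1 =
    fun y => (prefix_prod (Ordinal jm) y * y (Ordinal jm))%g).
  apply: smooth_at_mulg; [exact: regular_power_lie | exact/IH/ltnW |].
  exact: smooth_at_coord.
by apply/funext => y; exact: (prefix_prodS (Ordinal jm)).
Qed.

Lemma smooth_at_rprod x : smooth_at (@rprod R n G m) x.
Proof.
rewrite (_ : @rprod R n G m = prefix_prod m).
  exact: smooth_at_prefix_prod.
by apply/funext => y; rewrite prefix_prod_rprod.
Qed.

(** * Hurwitz moves: prefix products, smoothness and tangency *)

Section Hurwitz.
Variable k : 'I_m.-1.

Lemma hurwitz_pos1 x :
  hurwitz k x (pos1 k) = (x (pos1 k) * x (pos2 k) * (x (pos1 k))^-1)%g.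
Proof. by rewrite /hurwitz eqxx. Qed.

Lemma hurwitz_pos2 x : hurwitz k x (pos2 k) = x (pos1 k).
Proof. by rewrite /hurwitz pos21 eqxx. Qed.

Lemma hurwitz_out x i : i != pos1 k -> i != pos2 k -> hurwitz k x i = x i.
Proof. by rewrite /hurwitz => /negbTE -> /negbTE ->. Qed.

Lemma prefix_prod_hurwitz_le j x : (j <= k)%N ->
  prefix_prod j (hurwitz k x) = prefix_prod j x.
Proof.
move=> jk; apply: eq_bigr => i ij; have ik := leq_trans ij jk.
by rewrite hurwitz_out // -val_eqE /= ltn_eqF // ltnW.
Qed.

Lemma prefix_prod_hurwitz_pos1 x :
  prefix_prod k.+1 (hurwitz k x) = (prefix_prod k x * hurwitz k x (pos1 k))%g.
Proof. by rewrite (prefix_prodS (pos1 k)) prefix_prod_hurwitz_le. Qed.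

(** The two moved entries have product [(a b a^-1) a = a b], so a prefix containing both keeps its
    product; only the prefix of length [k.+1] separates them. *)
Lemma prefix_prod_hurwitz_gt j x : (k.+1 < j)%N -> (j <= m)%N ->
  prefix_prod j (hurwitz k x) = prefix_prod j x.
Proof.
elim: j => // j IH; rewrite ltnS leq_eqVlt => /predU1P[<- km|kj jm].
  rewrite !(prefix_prodS (pos2 k)) prefix_prod_hurwitz_pos1.
  by rewrite (prefix_prodS (pos1 k)) hurwitz_pos1 hurwitz_pos2 !mulgA mulgVK.
rewrite !(prefix_prodS (Ordinal jm)) /= IH //; last exact: ltnW.
by rewrite hurwitz_out // -val_eqE /= gtn_eqF // ltnW.
Qed.

Lemma rprod_hurwitz x : rprod (hurwitz k x) = rprod x.
Proof.
rewrite -!prefix_prod_rprod prefix_prod_hurwitz_gt //.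
exact: ord_pred_succ_lt.
Qed.

Lemma smooth_at_hurwitz x : smooth_at (hurwitz k : power m G -> power m G) x.
Proof.
have rx := regular_power_lie x; have sx := smooth_at_coord x.
apply: smooth_at_power => i; rewrite /hurwitz.
case: (i == pos1 k); last by case: (i == pos2 k).
do 2?apply: smooth_at_mulg => //; exact: smooth_at_invg.
Qed.

Lemma smooth_at_hurwitz_inv x :
  smooth_at (hurwitz_inv k : power m G -> power m G) x.
Proof.
have rx := regular_power_lie x; have sx := smooth_at_coord x.
apply: smooth_at_power => i; rewrite /hurwitz_inv.
case: (i == pos1 k) => //; case: (i == pos2 k) => //.
do 2?apply: smooth_at_mulg => //; exact: smooth_at_invg.
Qed.

Lemma tangent_hurwitz x A : tangent_class x A ->
  tangent_class (hurwitz k x : power m G)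
    (mdiff (hurwitz k : power m G -> power m G) x A).
Proof.
have rx := regular_power_lie x; have sx := smooth_at_coord x.
move=> /tangent_classP tA; apply/tangent_classP => i.
rewrite dlogR_comp; [|exact: smooth_at_hurwitz|exact: smooth_at_coord].
rewrite /hurwitz; case: (i == pos1 k); first exact: dlogR_conjg_orbit.
by case: (i == pos2 k).
Qed.

Lemma tangent_hurwitz_inv x A : tangent_class x A ->
  tangent_class (hurwitz_inv k x : power m G)
    (mdiff (hurwitz_inv k : power m G -> power m G) x A).
Proof.
have rx := regular_power_lie x; have sx := smooth_at_coord x.
move=> /tangent_classP tA; apply/tangent_classP => i.
rewrite dlogR_comp; [|exact: smooth_at_hurwitz_inv|exact: smooth_at_coord].
rewrite /hurwitz_inv; case: (i == pos1 k) => //; case: (i == pos2 k) => //.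
(* The inverse move conjugates [a] by [b^-1], so the conjugation rule is used with [f = b^-1], and
   [invgK] removes the double inverse. *)
have sV := smooth_at_invg rx (sx (pos2 k)).
have := dlogR_conjg_orbit rx sV (sx (pos1 k)) (tA (pos1 k)).
by under [X in dlogR _ X]eq_fun do rewrite invgK; rewrite invgK.
Qed.

End Hurwitz.
End PowerOfGroup.

(** * Invariance of the form under braids *)

Section BraidInvariance.
Context {R : realType} {n : nat} {G : lieGroupType R n} {m : nat}.
Variables (dot : 'rV[R]_n -> 'rV[R]_n -> R) (O : set 'rV[R]_n) (C U : set G).
Hypotheses (dotP : invariant_inner_product G dot) (expO : exp_domain G O).
Hypotheses (conjC : conjugacy_class C)
  (centralC : forall p : G, C p -> forall g : G, commute (p ^+ 2)%g g)
  (UO : U `<=` [set lie_exp G X | X in O]).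
Implicit Types (x y : power m G) (A B : 'M[R]_(m, n)) (k : 'I_m.-1).

Let S : set (power m G) := class_preimage C U.

(** The chain rule turns the pullback into logarithmic derivatives of composed maps at [x]. The
    summand [j = 0], absent from [omega_c], may be included because the empty prefix product is
    constant. *)
Lemma pullback_omega_c (f : power m G -> power m G) x A B : smooth_at f x ->
  omega_c dot (f x) (mdiff f x A) (mdiff f x B) =
  - \sum_(j < m) 2^-1 * dlog_form dot x (fun y => prefix_prod j (f y))
      (fun y => f y j) A B.
Proof.
move=> sf; rewrite /omega_c; congr (- _); rewrite big_mkcond /=.
apply: eq_bigr => j _; case: ifPn => [_|].
  rewrite (pullback_Omega dot); first last.
  - exact: smooth_at_coord.
  - by apply: smooth_at_prefix_prod; exact: ltnW.
  congr (_ * _); rewrite /dlog_form !dlogL_comp ?dlogR_comp //;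
    solve [exact: smooth_at_coord
          | by apply: smooth_at_prefix_prod; exact: ltnW].
rewrite -eqn0Ngt => /eqP ->.
rewrite (_ : (fun y => prefix_prod 0 (f y)) = fun=> 1%g).
  by rewrite dlog_form_cst // mulr0.
by apply/funext => y; rewrite prefix_prod0.
Qed.

Lemma omega_cE x A B : omega_c dot x A B =
  - \sum_(j < m) 2^-1 * dlog_form dot x (prefix_prod j) (fun y => y j) A B.
Proof.
have rx := regular_power_lie x.
have := @pullback_omega_c (fun y => y) x A B (smooth_at_id rx).
by rewrite !mdiff_id.
Qed.

Lemma smooth_at_log_rprod x : S x ->
  smooth_at (fun y : power m G => lie_log O (rprod y)) x.
Proof.
move=> [_ /UO Ux]; apply: (smooth_at_comp (f := @rprod R n G m)).
- exact: regular_power_lie.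
- exact: regular_lie.
- exact: smooth_at_rprod.
- exact: (exp_domain_smooth_log expO).
- exact: has_coordinates_mx.
Qed.

Lemma class_conj g h : C g -> C (h * g * h^-1)%g.
Proof.
have [p ->] := conjC => -[h' _ <-]; exists (h * h')%g => //.
by rewrite invgM !mulgA.
Qed.

Lemma hurwitz_preserves k x : S x -> S (hurwitz k x).
Proof.
move=> [Cx Ux]; split; last by rewrite rprod_hurwitz.
by move=> i; rewrite /hurwitz; case: ifP => _; [exact: class_conj | case: ifP].
Qed.

Lemma hurwitz_invK k x : hurwitz k (hurwitz_inv k x) = x.
Proof. exact: (letter_actK k true). Qed.

Lemma hurwitz_inv_preserves k x : S x -> S (hurwitz_inv k x).
Proof.
move=> [Cx Ux]; split; last by rewrite -(rprod_hurwitz k) hurwitz_invK.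
move=> i; rewrite /hurwitz_inv; case: ifP => _ //; case: ifP => _ //.
by have := class_conj (x (pos2 k))^-1%g (Cx (pos1 k)); rewrite invgK.
Qed.

Lemma adj_class g : C g -> involutive (adj g).
Proof. by move=> Cg; apply: adj_involutive; exact: centralC. Qed.

Lemma pullback_hurwitz k x A B :
  S x -> tangent_class x A -> tangent_class x B ->
  pullback2 (hurwitz k : power m G -> power m G) (omegaC dot O) x A B =
  omegaC dot O x A B.
Proof.
move=> Sx /tangent_classP tA /tangent_classP tB.
have rx := regular_power_lie x; have sx := smooth_at_coord x.
have sh := smooth_at_hurwitz k x; have Shx := hurwitz_preserves k Sx.
(* Both [x] and its image lie in [S], so all the [tau] terms on either side vanish. *)
have tau0 y u v i : S y -> tau dot (y i) u v = 0.
  by move=> [Cy _]; apply: tau_involutive => //; exact: adj_class.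
rewrite {1}/pullback2 /omegaC.
rewrite [X in _ + X]big1; last by move=> i _; exact: tau0.
rewrite [X in _ = _ + X]big1; last by move=> i _; exact: tau0.
congr (_ - _ + _).
  rewrite pullback_omega_c // omega_cE; congr (- _).
  have p21 : pos2 k != pos1 k by rewrite pos21.
  (* The summands at the two moved positions are isolated on each side; it is their sum that
     [dlog_form_conjg] preserves. *)
  rewrite (bigD1 (pos1 k)) // (bigD1 (pos2 k)) //=.
  rewrite [RHS](bigD1 (pos1 k)) // [in RHS](bigD1 (pos2 k)) //=.
  rewrite !addrA; congr (_ + _).
    rewrite -!mulrDr; congr (_ * _).
    have bA : involutive (adj (x (pos2 k))) by apply: adj_class; case: Sx.
    have sP : smooth_at (prefix_prod k) x.
      by apply: smooth_at_prefix_prod; exact/ltnW/ord_pred_lt.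
    have := dlog_form_conjg dotP rx sP (sx (pos1 k)) (sx (pos2 k)) bA
      (tA (pos2 k)) (tB (pos2 k)).
    (* As [pos2 k] has value [k.+1], its prefix product is the one at [k] times the entry at
       [pos1 k], the shape in which the conjugation lemma expects it. *)
    rewrite (@eq_dlog_form _ _ _ _ _ _ _ (prefix_prod (pos2 k))
      (fun y => prefix_prod k y * y (pos1 k))%g _
      (fun y => y (pos2 k))) => [<-||] //.
      congr (_ + _); apply: eq_dlog_form => y /=.
      + exact: prefix_prod_hurwitz_le.
      + exact: hurwitz_pos1.
      + by rewrite prefix_prod_hurwitz_pos1 hurwitz_pos1.
      + exact: hurwitz_pos2.
    by move=> y; exact: (prefix_prodS (pos1 k)).
  apply: eq_bigr => j /andP[j1 j2]; congr (_ * _).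
  apply: eq_dlog_form => y; last exact: hurwitz_out.
  (* For the remaining indices the prefix contains neither or both of the moved entries: [k < j]
     with [j] distinct from [pos2 k] means [k.+1 < j]. *)
  have [jk|kj] := leqP j k; first exact: prefix_prod_hurwitz_le.
  apply: prefix_prod_hurwitz_gt; last exact: ltnW.
  by rewrite ltn_neqAle kj andbT eq_sym.
(* In the [beta] term, the logarithm of [rprod] is the same function before and after the move, so
   by the chain rule its differential takes the same values on the transported vectors. *)
rewrite /pullback2 rprod_hurwitz.
have sl := smooth_at_log_rprod Shx.
rewrite -!(mdiff_comp (g := fun y : power m G => lie_log O (rprod y))
    _ _ sh sl); try exact: regular_power_lie.
rewrite (_ : _ \o _ = fun y => lie_log O (rprod y)) //.
by apply/funext => y /=; rewrite rprod_hurwitz.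
Qed.

(** The form identity is asserted only at points of [S] and on tangent vectors to the classes.
    Preservation of both, together with smoothness, makes the property stable under composition. *)
Definition form_preserving (f : power m G -> power m G) :=
  [/\ forall x, smooth_at f x,
      forall x, S x -> S (f x),
      forall x A, tangent_class x A -> tangent_class (f x) (mdiff f x A) &
      forall x A B, S x -> tangent_class x A -> tangent_class x B ->
        pullback2 f (omegaC dot O) x A B = omegaC dot O x A B].

Lemma form_preserving_id : form_preserving id.
Proof.
have rx := regular_power_lie.
split=> // [x|x A tA|x A B _ _ _]; first exact: smooth_at_id.
  by rewrite mdiff_id.
by rewrite /pullback2 !mdiff_id.
Qed.

Lemma mdiff_comp_power (f g : power m G -> power m G) x A :
  smooth_at f x -> smooth_at g (f x) ->
  mdiff (fun y => g (f y)) x A = mdiff g (f x) (mdiff f x A).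
Proof.
by move=> sf sg; apply: (mdiff_comp (g := g)) => //; exact: regular_power_lie.
Qed.

Lemma form_preserving_comp (f g : power m G -> power m G) :
  form_preserving f -> form_preserving g ->
  form_preserving (fun y => g (f y)).
Proof.
move=> [sf Sf tf pf] [sg Sg tg pg]; split=> [x|x Sx|x A tA|x A B Sx tA tB].
- apply: (smooth_at_comp (g := g)) => //; try exact: regular_power_lie.
  exact: has_coordinates_mx.
- exact/Sg/Sf.
- rewrite (mdiff_comp_power A (sf x) (sg (f x))); exact/tg/tf.
- rewrite -(pf x A B Sx tA tB) [RHS]/pullback2.
  rewrite -(pg _ _ _ (Sf x Sx) (tf x A tA) (tf x B tB)).
  by rewrite /pullback2 !(mdiff_comp_power _ (sf x) (sg (f x))).
Qed.

Lemma form_preserving_hurwitz k : form_preserving (hurwitz k).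
Proof.
split; [exact: smooth_at_hurwitz | exact: hurwitz_preserves | |].
  exact: tangent_hurwitz.
exact: pullback_hurwitz.
Qed.

(** The identity for [hurwitz k] is applied at [hurwitz_inv k x] to the vectors transported there;
    since [hurwitz k] undoes [hurwitz_inv k], the chain rule returns the original vectors. *)
Lemma form_preserving_hurwitz_inv k : form_preserving (hurwitz_inv k).
Proof.
have sh (y : power m G) := smooth_at_hurwitz k y.
have sh' (y : power m G) := smooth_at_hurwitz_inv k y.
split=> [//|x Sx|x A tA|x A B Sx tA tB].
- exact: hurwitz_inv_preserves.
- exact: tangent_hurwitz_inv.
- have := pullback_hurwitz k (hurwitz_inv_preserves k Sx)
    (tangent_hurwitz_inv k tA) (tangent_hurwitz_inv k tB).
  rewrite /pullback2 => <-; rewrite -!(mdiff_comp_power _ (sh' x) (sh _)).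
  have -> : (fun y : power m G => hurwitz k (hurwitz_inv k y)) = id.
    by apply/funext => y; rewrite hurwitz_invK.
  by rewrite hurwitz_invK !mdiff_id //; exact: regular_power_lie.
Qed.

(** A braid acts through a representing word, hence as a composition of Hurwitz moves and their
    inverses; the induction is on that word. *)
Lemma form_preserving_braid_act (s : braid m) : form_preserving (braid_act s).
Proof.
rewrite /braid_act; elim: (repr s) => [|[k b] w IH].
  exact: form_preserving_id.
have fb : form_preserving (letter_act (k, b)).
  by case: b;
    [exact: form_preserving_hurwitz | exact: form_preserving_hurwitz_inv].
exact: (form_preserving_comp IH fb).
Qed.

End BraidInvariance.

Unset Implicit Arguments.

Theorem theorem4p1 (R : realType) (n : nat) (G : lieGroupType R n)
    (dot : 'rV[R]_n -> 'rV[R]_n -> R) (O : set 'rV[R]_n)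
    (C : set G) (m : nat) (U : set G) :
  compact [set: G] ->
  invariant_inner_product G dot ->
  exp_domain G O ->
  conjugacy_class C ->
  (forall p : G, C p -> forall g : G, commute (p ^+ 2)%g g) ->
  (1 <= m)%N ->
  open U -> U 1%g -> (forall g h : G, U g -> U (h * g * h^-1)%g) ->
  U `<=` [set lie_exp G X | X in O] ->
  symplectic (class_preimage (m := m) C U) (tangent_class (m := m))
    (omegaC dot O) ->
  forall s : braid m,
    symplectomorphism (class_preimage C U) (@tangent_class R n G m)
      (omegaC dot O) (@braid_act m G s).
Proof.
move=> _ dotP expO conjC centralC _ _ _ _ UO _ s.
have fp :=
  @form_preserving_braid_act R n G m _ _ _ _ dotP expO conjC centralC UO.
have actK (t : braid m) (x : power m G) : braid_act t^-1%g (braid_act t x) = x.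
  by rewrite -braid_actM mulVg braid_act1.
have actVK (t : braid m) (x : power m G) : braid_act t (braid_act t^-1%g x) = x.
  by rewrite -braid_actM mulgV braid_act1.
(* The action is defined and smooth on the whole power of [G], which serves as the neighbourhood. *)
have snear t : smooth_near (class_preimage C U)
    (braid_act t : power m G -> power m G).
  have [st _ _ _] := fp t.
  by exists setT; split; [exact: openT | by [] | move=> x _; exact: st].
(* The inverse braid preserves the same set, which gives surjectivity and, with its smoothness, the
   smooth inverse. *)
have [_ Ss _ ps] := fp s; have [_ Ss' _ _] := fp s^-1%g.
split; [split | exact: snear | | exact: ps].
- by [].
- by move=> x y _ _ /(congr1 (braid_act s^-1%g)); rewrite !actK.
- by move=> y Sy; exists (braid_act s^-1%g y); [exact: Ss' | exact: actVK].
- by exists (braid_act s^-1%g); [move=> x _; exact: actK | exact: snear].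
Qed.
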